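(* Let $1<\alpha<2$, $1<\beta<2$, $0<\eta<1$, $0<\xi<1$, $\lambda>0$, $\mu>0$. Let $\psi\in C^2([0,1],\mathbb{R})$ be increasing with $\psi'(t)\neq 0$ for all $t\in[0,1]$, and suppose that $$\Delta_1=\lambda(\psi(\eta)-\psi(0))-(\psi(1)-\psi(0))\neq 0,\qquad \Delta_2=\mu(\psi(\xi)-\psi(0))-(\psi(1)-\psi(0))\neq 0.$$ Let $f,g:[0,1]\times\mathbb{R}^2\to\mathbb{R}$ be continuous, and suppose there exist real constants $L_1,L_2>0$ such that for all $t\in[0,1]$ and all $x_1,x_2,y_1,y_2\in\mathbb{R}$, $$|f(t,x_1,y_1)-f(t,x_2,y_2)|\leq L_1(|x_1-x_2|+|y_1-y_2|),$$ $$|g(t,x_1,y_1)-g(t,x_2,y_2)|\leq L_2(|x_1-x_2|+|y_1-y_2|).$$ Put $$\gamma_3=\frac{L_1}{\Gamma(\alpha+1)}\left[(\psi(1)-\psi(0))^{\alpha}+\frac{|\lambda|+1}{|\Delta_1|}(\psi(1)-\psi(0))^{\alpha+1}\right],$$ $$\gamma_4=\frac{L_2}{\Gamma(\beta+1)}\left[(\psi(1)-\psi(0))^{\beta}+\frac{|\mu|+1}{|\Delta_2|}(\psi(1)-\psi(0))^{\beta+1}\right].$$ If $\gamma_3+\gamma_4<1$, then the coupled system $$\begin{cases}{}^{C}D_{0^{+}}^{\alpha;\psi}x(t)=f(t,x(t),y(t)), & t\in[0,1],\\ {}^{C}D_{0^{+}}^{\beta;\psi}y(t)=g(t,x(t),y(t)),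 & t\in[0,1],\\ x(0)=y(0)=0,\\ x(1)=\lambda x(\eta),\quad y(1)=\mu y(\xi)\end{cases}$$ has a unique solution on $[0,1]$.
   Context: $\Gamma$ is the Euler Gamma function. For $\theta>0$ and an integrable $\sigma:[0,1]\to\mathbb{R}$, the left-sided $\psi$-Riemann-Liouville fractional integral of order $\theta$ is $$I_{0^+}^{\theta;\psi}\sigma(t)=\frac{1}{\Gamma(\theta)}\int_0^t\psi'(s)(\psi(t)-\psi(s))^{\theta-1}\sigma(s)\,ds .$$ For $1<\theta<2$ and $\psi,\sigma\in C^2([0,1],\mathbb{R})$ with $\psi$ increasing and $\psi'(t)\neq0$ on $[0,1]$, the left-sided $\psi$-Riemann-Liouville derivative of order $\theta$ is $$D_{0^+}^{\theta;\psi}\sigma(t)=\left(\frac{1}{\psi'(t)}\frac{d}{dt}\right)^{2}I_{0^+}^{2-\theta;\psi}\sigma(t),$$ and the left-sided $\psi$-Caputo fractional derivative of order $\theta$ is $${}^{C}D_{0^+}^{\theta;\psi}\sigma(t)=D_{0^+}^{\theta;\psi}\left[\sigma(t)-\sum_{k=0}^{1}\frac{\sigma_\psi^{[k]}(0)}{k!}(\psi(t)-\psi(0))^k\right],\qquad \sigma_\psi^{[k]}(t)=\left(\frac{1}{\psi'(t)}\frac{d}{dt}\right)^{k}\sigma(t),$$ which for such $\sigma$ equals $I_{0^+}^{2-\theta;\psi}\sigma_\psi^{[2]}(t)$. Solutions $(x,y)$ of the system are considered as elements of $X\times Y$, where $X=Y=C([0,1],\mathbb{R})$ with the supremum norm and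 $\|(x,y)\|_{X\times Y}=\|x\|_X+\|y\|_Y$. *)

(* Defs.v *)
From HB Require Import structures.
From mathcomp Require Import all_boot all_order all_algebra.
From mathcomp Require Import all_classical all_reals all_analysis.

Set Implicit Arguments.
Unset Strict Implicit.
Unset Printing Implicit Defensive.

Import Order.TTheory GRing.Theory Num.Theory.
Import numFieldNormedType.Exports.

Local Open Scope classical_set_scope.
Local Open Scope ring_scope.

Definition Gamma {R : realType} (theta : R) : R :=
  (\int[lebesgue_measure]_(u in `]0%R, +oo[) (u `^ (theta - 1) * expR (- u)))%R.

(* A function on [0,1] is represented by a total function on R of which only
   the values on [0,1] matter.  Accordingly, derivatives are relative to
   [0,1], hence one-sided at 0 and at 1 (the library's [derive1] is two-sided
   and would depend on values outside [0,1]). *)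
Definition diffquot01 {R : realType} (s : R -> R) (t : R) : set_system R :=
  (s u - s t) / (u - t) @[u --> within `[0, 1] t^'].

Definition derivable01 {R : realType} (s : R -> R) (t : R) : Prop :=
  cvg (diffquot01 s t).

Definition deriv01 {R : realType} (s : R -> R) (t : R) : R :=
  lim (diffquot01 s t).

Definition C2_01 {R : realType} (s : R -> R) : Prop :=
  [/\ {in `[0, 1], forall t, derivable01 s t},
      {in `[0, 1], forall t, derivable01 (deriv01 s) t} &
      {within `[0, 1], continuous (deriv01 (deriv01 s))}].

(* (1/psi' d/dt) s *)
Definition psi_deriv {R : realType} (psi s : R -> R) (t : R) : R :=
  (deriv01 psi t)^-1 * deriv01 s t.

(* (1/psi' d/dt)^k s, which is also s_psi^[k] *)
Definition psi_derivn {R : realType} (k : nat) (psi s : R -> R) : R -> R :=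
  iter k (psi_deriv psi) s.

(* The kernel takes the value 0 instead of +oo at u = t when 0 < theta < 1;
   this concerns a single point. *)
Definition frac_int {R : realType} (theta : R) (psi s : R -> R) (t : R) : R :=
  (Gamma theta)^-1 *
  (\int[lebesgue_measure]_(u in `[0%R, t])
     (deriv01 psi u * (psi t - psi u) `^ (theta - 1) * s u))%R.

(* Riemann-Liouville derivative, for 1 < theta < 2 *)
Definition RL_deriv {R : realType} (theta : R) (psi s : R -> R) : R -> R :=
  psi_derivn 2 psi (frac_int (2 - theta) psi s).

Definition RL_derivable {R : realType} (theta : R) (psi s : R -> R) : Prop :=
  forall k : nat, (k < 2)%N -> {in `[0, 1], forall t,
    derivable01 (psi_derivn k psi (frac_int (2 - theta) psi s)) t}.

Definition taylor_rem {R : realType} (psi s : R -> R) (t : R) : R :=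
  s t - \sum_(k < 2) psi_derivn k psi s 0 / k`!%:R * (psi t - psi 0) ^+ k.

(* Caputo derivative, for 1 < theta < 2 *)
Definition caputo_deriv {R : realType} (theta : R) (psi s : R -> R) : R -> R :=
  RL_deriv theta psi (taylor_rem psi s).

(* All derivatives occurring in the formula for [caputo_deriv] exist; this
   does not force s to be C^2, which fails at 0 for solutions of
   fractional equations with continuous right-hand side. *)
Definition caputo_derivable {R : realType} (theta : R) (psi s : R -> R) : Prop :=
  derivable01 s 0 /\ RL_derivable theta psi (taylor_rem psi s).

Definition is_solution {R : realType} (alpha beta eta xi lambda mu : R)
    (psi : R -> R) (f g : R -> R -> R -> R) (x y : R -> R) : Prop :=
  [/\ {within `[0, 1], continuous x} /\ {within `[0, 1], continuous y},
      caputo_derivable alpha psi x /\ caputo_derivable beta psi y,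
      {in `[0, 1], forall t, caputo_deriv alpha psi x t = f t (x t) (y t) /\
                             caputo_deriv beta psi y t = g t (x t) (y t)},
      x 0 = 0 /\ y 0 = 0 &
      x 1 = lambda * x eta /\ y 1 = mu * y xi].

(* Main.v *)
Require Import Defs.
From HB Require Import structures.
From mathcomp Require Import all_boot all_order all_algebra.
From mathcomp Require Import all_classical all_reals all_analysis.
From mathcomp Require Import measurable_realfun ring lra.

Import Order.TTheory GRing.Theory Num.Theory.
Import numFieldNormedType.Exports.

Local Open Scope classical_set_scope.
Local Open Scope ring_scope.

(* In the variable v = psi t - psi 0 the psi-fractional integrals become
   ordinary Riemann-Liouville integrals RL a, and the Beta integral gives the
   semigroup law RL a (RL b w) = RL (a + b) w.  If the Caputo derivative of x
   is w, then the Taylor remainder r of x satisfies RL (2 - a) r = RL 2 w; the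
   other primitives are excluded by r = O(v), hence RL (2 - a) r = O(v^(3 - a)).
   Applying RL (a - 1) gives RL 1 r = RL 1 (RL a w), and differentiating
   r = RL a w.  So x solves the equation if and only if x = RL a w + c v, where
   c is determined by the boundary condition.  The system thereby becomes a
   fixed point problem for a pair of operators that contracts the norm
   |x| + |y| by the factor gamma3 + gamma4. *)

(** A solution need not be C^2 at 0, so its Caputo derivative cannot be rewritten as a fractional
    integral of a second derivative. All that is known is that the fractional integral [h] of order
    2 - a of the Taylor remainder can be differentiated twice, with result [w]. Two integration
    constants remain: the value of [h] at 0 vanishes because the domain of integration shrinks to a
    point, its slope because 3 - a > 1. Functions matter on [0,1] only. An inverse [q] of psi - psi
    0, extended continuously to the whole line with values in [0,1], turns them into continuous
    functions on R, where the fractional calculus is carried out. Gamma is just an integral here;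
    its recurrence comes from the Beta identity, which is proved in the extended reals, before
    finiteness is known. With T = psi 1 - psi 0, the bracket in gamma3 adds two bounds: T^alpha for
    the fractional integral, and one for the linear term c v, where |lambda| + 1 comes from the two
    values in the boundary condition, 1 / |Delta1| from solving for c, and the extra factor T from v
    <= T. *)

Section LebesgueAffine.
Context {R : realType}.
Local Notation mu := (@lebesgue_measure R).
Local Open Scope ereal_scope.

Let T := measurableTypeR R.

(** The image of Lebesgue measure under the shift gives each interval []a, b]] its length, so
    uniqueness of Lebesgue measure identifies the two; the rest is integration against a
    pushforward. *)
Lemma integral_translate (f : R -> \bar R) (c : R) :
  measurable_fun setT f -> (forall x, 0 <= f x) ->
  \int[mu]_x f x = \int[mu]_x f (x - c)%R.
Proof.
move=> mf f0.
have mh : measurable_fun setT (fun x : R => (x - c)%R : R).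
  by apply: measurable_funB => //; exact: measurable_cst.
transitivity (\int[pushforward mu ((fun x : R => (x - c)%R) : T -> T)]_(x in setT)
   (f : T -> \bar R) x).
  apply: eq_measure_integral => A mA _.
  apply: (@lebesgue_measure_unique R
    (pushforward mu ((fun x : R => (x - c)%R) : T -> T))) => //.
  move=> X [[a b]] _ <-.
  rewrite /pushforward.
  rewrite [X in _ = mu X](_ : _ = `](a + c)%R, (b + c)%R]%classic); last first.
    by apply/seteqP; split => x /=; rewrite !in_itv/= ltrBrDr lerBlDr.
  rewrite !lebesgue_measure_itv/= !lte_fin ltrD2r.
  by case: ifP => // _; rewrite -!EFinB; congr EFin; ring.
by rewrite ge0_integral_pushforward.
Qed.

(** Same argument as for translations, except that the dilation divides lengths by [c]; the
    pushforward is rescaled by [c] before uniqueness is invoked. *)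
Lemma integral_scale (f : R -> \bar R) (c : R) : (0 < c)%R ->
  measurable_fun setT f -> (forall x, 0 <= f x) ->
  \int[mu]_x f x = c%:E * \int[mu]_x f (c * x)%R.
Proof.
move=> c0 mf f0.
pose h : T -> T := fun x : R => (c * x)%R.
have mh : measurable_fun setT h by exact: mulrl_measurable.
pose hmu : {measure set T -> \bar R} :=
  measure_function_pushforward__canonical__measure_function_Measure mu mh.
transitivity (\int[mscale (NngNum (ltW c0)) hmu]_(x in setT) (f : T -> \bar R) x).
  apply: eq_measure_integral => A mA _.
  apply: (@lebesgue_measure_unique R (mscale (NngNum (ltW c0)) hmu)) => //.
  move=> X [[a b]] _ <-.
  rewrite /mscale /= /pushforward.
  rewrite [X in _ = (_ * mu X)%E](_ : _ = `](a / c)%R, (b / c)%R]%classic); last first.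
    apply/seteqP; split => x /=; rewrite !in_itv/= /h;
    by rewrite ltr_pdivrMr// ler_pdivlMr// mulrC.
  rewrite !lebesgue_measure_itv/= !lte_fin ltr_pM2r ?invr_gt0//.
  case: ifP => // _; last by rewrite mule0.
  by rewrite -!EFinB -EFinM; congr EFin; field; rewrite gt_eqF.
by rewrite ge0_integral_mscale//= ge0_integral_pushforward.
Qed.
End LebesgueAffine.

(** * Power kernels, their convolutions and the Beta integral *)

Section BetaIntegral.
Context {R : realType}.
Local Notation mu := (@lebesgue_measure R).

(* With the kernel extended by 0, fractional integrals are convolutions on the
   whole line; the factor [kp 1 v] restricts them to [v > 0]. *)
Definition kp (a x : R) : R := if 0 < x then x `^ (a - 1) else 0.

Lemma kp_ge0 (a x : R) : 0 <= kp a x.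
Proof. by rewrite /kp; case: ifP => // _; exact: powR_ge0. Qed.

Lemma kp_le0 (a x : R) : x <= 0 -> kp a x = 0.
Proof. by rewrite /kp leNgt => /negbTE ->. Qed.

Lemma kp_gt0 (a x : R) : 0 < x -> kp a x = x `^ (a - 1).
Proof. by rewrite /kp => ->. Qed.

Lemma kp1_gt0 (x : R) : 0 < x -> kp 1 x = 1.
Proof. by move=> x0; rewrite kp_gt0// subrr powRr0. Qed.

Lemma kp1_le1 (x : R) : kp 1 x <= 1.
Proof. by case: (ltP 0 x) => x0; [rewrite kp1_gt0|rewrite kp_le0]. Qed.

Lemma kpZ (a c x : R) : 0 < c -> kp a (c * x) = c `^ (a - 1) * kp a x.
Proof.
move=> c0; case: (ltP 0 x) => x0; last by rewrite !kp_le0 ?mulr0// pmulr_rle0.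
by rewrite !kp_gt0 ?mulr_gt0// powRM// ltW.
Qed.

Lemma measurable_kp (a : R) : measurable_fun setT (kp a).
Proof.
apply: measurable_fun_ifT.
- by apply: measurable_fun_ltr => //; exact: measurable_cst.
- exact: measurable_powR.
- exact: measurable_cst.
Qed.

Lemma measurable_kpD d (T : measurableType d) (a : R) (h : T -> R) :
  measurable_fun setT h -> measurable_fun setT (fun x => kp a (h x)).
Proof. by move=> mh; exact: (measurableT_comp (measurable_kp a)). Qed.

Local Open Scope ereal_scope.

(** Extended-real Gamma function: Tonelli applies to it while finiteness is still open. *)
Definition egamma (a : R) : \bar R := \int[mu]_x (kp a x * expR (- x))%:E.

(** At t = 1 this is the Beta function B(a, b). *)
Definition kpconv (a b t : R) : \bar R :=
  \int[mu]_x (kp a (t - x) * kp b x)%:E.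

Lemma GammaE (a : R) : Gamma a = fine (egamma a).
Proof.
rewrite /Gamma Rintegral_mkcond /Rintegral; congr fine.
apply: eq_integral => x _; rewrite patchE.
case: ifPn; rewrite ?inE ?notin_setE/= in_itv/= andbT.
  by move=> x0; rewrite kp_gt0.
by move=> /negP; rewrite -leNgt => x0; rewrite kp_le0 ?mul0r.
Qed.

Lemma egamma_ge0 (a : R) : 0 <= egamma a.
Proof. by apply: integral_ge0 => x _; rewrite lee_fin mulr_ge0 ?kp_ge0 ?expR_ge0. Qed.

Lemma kpconv_ge0 (a b t : R) : 0 <= kpconv a b t.
Proof. by apply: integral_ge0 => x _; rewrite lee_fin mulr_ge0 ?kp_ge0. Qed.

Lemma measurable_kpconv_integrand (a b t : R) :
  measurable_fun setT (fun x : R => (kp a (t - x) * kp b x)%R).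
Proof.
apply: measurable_funM; last exact: measurable_kp.
apply: measurable_kpD; apply: measurable_funB => //; exact: measurable_cst.
Qed.

Lemma kpconvZl (a b t c : R) : (0 <= c)%R ->
  \int[mu]_x (c * (kp a (t - x) * kp b x))%:E = c%:E * kpconv a b t.
Proof.
move=> c0; rewrite -ge0_integralZl_EFin//.
- by move=> x _; rewrite lee_fin mulr_ge0 ?kp_ge0.
- by apply/measurable_EFinP; exact: measurable_kpconv_integrand.
Qed.

(** Substituting t x for x extracts the powers a - 1 and b - 1 of t from the kernels and one more
    from dx. For t <= 0 both sides are 0, by the convention 0 * +oo = 0 if need be, so finiteness of
    [kpconv a b 1] is not presupposed. *)
Lemma kpconv_scale (a b t : R) : (0 < a)%R -> (0 < b)%R ->
  kpconv a b t = (kp (a + b) t)%:E * kpconv a b 1.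
Proof.
move=> a0 b0; case: (ltP 0%R t) => t0; last first.
  rewrite (kp_le0 _ _ t0) mul0e /kpconv integral0_eq// => x _.
  case: (ltP 0%R x) => x0; last by rewrite (kp_le0 b)// mulr0.
  by rewrite (kp_le0 a) ?mul0r//; lra.
rewrite /kpconv (integral_scale _ t t0); last 2 first.
- by apply/measurable_EFinP; exact: measurable_kpconv_integrand.
- by move=> x; rewrite lee_fin mulr_ge0 ?kp_ge0.
transitivity (t%:E * \int[mu]_x ((t `^ (a - 1) * t `^ (b - 1))%:E * (kp a (1 - x) * kp b x)%:E)).
  congr (_ * _); apply: eq_integral => x _; rewrite -EFinM; congr EFin.
  by rewrite -[X in kp a (X - _)]mulr1 -mulrBr !kpZ//; ring.
rewrite ge0_integralZl_EFin//; last 3 first.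
- by move=> x _; rewrite lee_fin mulr_ge0 ?kp_ge0.
- by apply/measurable_EFinP; exact: measurable_kpconv_integrand.
- by rewrite mulr_ge0 ?powR_ge0.
rewrite muleA -EFinM; congr (_%:E * _).
rewrite kp_gt0// -powRD; last by rewrite (gt_eqF t0) implybT.
rewrite -{1}(powRr1 (ltW t0)) -powRD; last by rewrite (gt_eqF t0) implybT.
congr (_ `^ _)%R; ring.
Qed.

Lemma measurable_egamma_integrand (c : R) :
  measurable_fun setT (fun x : R => (kp c x * expR (- x))%:E).
Proof.
apply/measurable_EFinP; apply: measurable_funM; first exact: measurable_kp.
by apply: measurableT_comp => //; exact: measurable_funN.
Qed.

(** Tonelli for exp(-x) (x - y)^(a-1) y^(b-1) on 0 < y < x. Integrating in y first gives a
    convolution, homogeneous in x. Integrating in x first, the shift by y splits exp(-x) into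
    exp(-(x-y)) exp(-y) and separates the variables. *)
Lemma egammaM (a b : R) : (0 < a)%R -> (0 < b)%R ->
  egamma a * egamma b = kpconv a b 1 * egamma (a + b).
Proof.
move=> a0 b0.
pose F (z : R * R) : \bar R :=
  (expR (- z.1) * (kp a (z.1 - z.2) * kp b z.2))%:E.
have mF : measurable_fun setT F.
  apply/measurable_EFinP; apply: measurable_funM.
    by apply: measurableT_comp => //; apply: measurable_funN; exact: measurable_fst.
  apply: measurable_funM; apply: measurable_kpD.
    by apply: measurable_funB; [exact: measurable_fst|exact: measurable_snd].
  exact: measurable_snd.
have F0 z : 0 <= F z by rewrite lee_fin !mulr_ge0 ?kp_ge0 ?expR_ge0.
have E1 : \int[mu]_x \int[mu]_y F (x, y) = kpconv a b 1 * egamma (a + b).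
  clear mF F0; rewrite muleC /egamma -ge0_integralZr//; last 3 first.
  - exact: measurable_egamma_integrand.
  - by move=> x _; rewrite lee_fin mulr_ge0 ?kp_ge0 ?expR_ge0.
  - exact: kpconv_ge0.
  apply: eq_integral => x _.
  move: (x : R) => {}x.
  transitivity ((expR (- x))%:E * kpconv a b x); first exact: (kpconvZl a b x _ (expR_ge0 (- x)%R)).
  by rewrite kpconv_scale// muleA -EFinM (mulrC (expR _)).
rewrite -E1; move: (fubini_tonelli (m1 := mu) (m2 := mu) F mF F0) => FT.
apply: (eq_trans _ (esym FT)) => {E1 FT mF F0}.
rewrite muleC /egamma -ge0_integralZr//; last 3 first.
- exact: measurable_egamma_integrand.
- by move=> x _; rewrite lee_fin mulr_ge0 ?kp_ge0 ?expR_ge0.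
- exact: egamma_ge0.
apply: eq_integral => y _; move: (y : R) => {}y.
have mF : measurable_fun setT (fun x : R => (kp a (x - y) * expR (- (x - y)))%:E).
  apply: (measurableT_comp (measurable_egamma_integrand a)).
  by apply: (@measurable_funB _ R R setT); [exact: measurable_id|exact: measurable_cst].
transitivity ((kp b y * expR (- y))%:E *
    \int[mu]_x (kp a (x - y) * expR (- (x - y)))%:E).
  congr (_ * _); apply: (@integral_translate R (fun x => (kp a x * expR (- x))%:E)).
    exact: measurable_egamma_integrand.
  by move=> x; rewrite lee_fin mulr_ge0 ?kp_ge0 ?expR_ge0.
rewrite -ge0_integralZl_EFin//; last 2 first.
- by move=> x _; rewrite lee_fin mulr_ge0 ?kp_ge0 ?expR_ge0.
- by rewrite mulr_ge0 ?kp_ge0 ?expR_ge0.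
apply: eq_integral => x _; rewrite -EFinM; congr EFin; rewrite /=.
have -> : expR (- x) = (expR (- (x - y)) * expR (- y))%R.
  by rewrite -expRD; congr expR; ring.
ring.
Qed.

Lemma egamma1 : egamma 1 = 1.
Proof.
rewrite -(@integral_exponential_pdf R 1%R)//.
have -> : egamma 1 = \int[mu]_(x in `]0%R, +oo[) (expR (- x))%:E.
  rewrite integral_mkcond; apply: eq_integral => x _; rewrite patchE.
  case: ifPn; rewrite ?inE ?notin_setE/= in_itv/= andbT.
    by move=> x0; rewrite kp1_gt0 ?mul1r.
  by move=> /negP; rewrite -leNgt => x0; rewrite kp_le0 ?mul0r.
rewrite integral_itv_obnd_cbnd; last first.
  apply/measurable_EFinP; apply: measurable_funTS.
  by apply: measurableT_comp => //; exact: measurable_funN.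
rewrite [RHS](_ : _ = \int[mu]_(x in `[0%R, +oo[) (exponential_pdf 1 x)%:E); last first.
  rewrite [RHS]integral_mkcond; apply: eq_integral => x _; rewrite patchE.
  by case: ifPn => // /negP; rewrite /exponential_pdf patchE => /negP/negbTE ->.
apply: eq_integral => x; rewrite inE/= in_itv/= andbT => x0.
by rewrite exponential_pdfE// mul1r mulN1r.
Qed.
End BetaIntegral.

(** * Finiteness, positivity and recurrence of Gamma *)

Section GammaValues.
Context {R : realType}.
Local Notation mu := (@lebesgue_measure R).

Lemma derivable_gt0_powR (a x : R) : 0 < x -> derivable (@powR R ^~ a) x 1.
Proof. by move=> x0; apply: derivable_powR; rewrite in_itv/= andbT. Qed.

Lemma continuous_gt0_powR (a x : R) : 0 < x -> {for x, continuous (@powR R ^~ a)}.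
Proof.
move=> x0; apply: differentiable_continuous.
by apply/derivable1_diffP; exact: derivable_gt0_powR.
Qed.

Lemma integral_powR (a e : R) : 0 < e < 1 ->
  (\int[mu]_(x in `[e, 1%R]) (a * x `^ (a - 1))%:E = (1 - e `^ a)%:E)%E.
Proof.
move=> /andP[e0 e1].
rewrite (@continuous_FTC2 R (fun x => a * x `^ (a - 1)) (@powR R ^~ a))//.
- by rewrite powR1.
- apply: continuous_in_subspaceT => x; rewrite inE/= in_itv/= => /andP[ex _].
  apply: cvgM; first exact: cvg_cst.
  by apply: continuous_gt0_powR; exact: lt_le_trans ex.
- split.
  + move=> x; rewrite in_itv/= => /andP[ex _].
    by apply: derivable_gt0_powR; exact: lt_trans ex.
  + by apply: cvg_at_right_filter; exact: continuous_gt0_powR.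
  + by apply: cvg_at_left_filter; exact: continuous_gt0_powR.
- move=> x; rewrite in_itv/= => /andP[ex _].
  by rewrite powR_derive1// in_itv/= andbT; exact: lt_trans ex.
Qed.

(** For a < 1 the integrand x^(a-1) is singular at 0, so the fundamental theorem is used away from 0
    and the intervals are then let grow to []0, 1]]. *)
Lemma kpconv1 (a : R) : 0 < a -> kpconv 1 a 1 = (a^-1)%:E.
Proof.
move=> a0.
(* The left endpoint is 1 / (n + 2): the shift keeps it strictly below 1 already at n = 0, as
   [integral_powR] requires. *)
pose F (n : nat) := `[@harmonic R n.+1, 1]%classic.
pose f (x : R) : \bar R := (a * x `^ (a - 1))%:E.
have mf : measurable_fun setT f.
  by apply/measurable_EFinP; apply: measurable_funM => //; exact: measurable_powR.
have f0 (x : R) : (0 <= f x)%E by rewrite lee_fin mulr_ge0 ?powR_ge0// ltW.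
have I1 : (\int[mu]_(x in \bigcup_n F n) f x = 1)%E.
  have C1 : (fun i => \int[mu]_(x in F i) f x)%E @ \oo --> (\int[mu]_(x in \bigcup_i F i) f x)%E.
    apply: ge0_nondecreasing_set_cvg_integral => //.
    - move=> m n mn; apply/subsetPset; apply: subset_itvr; rewrite bnd_simp.
      by rewrite lef_pV2 ?posrE ?ltr0n// ler_nat !ltnS.
    - by move=> i; exact: measurable_itv.
    - by move=> i; exact: measurable_funTS.
  apply: (cvg_unique _ C1) => //.
  have -> : (fun i => \int[mu]_(x in F i) f x)%E
      = (fun i => (1 - (harmonic i.+1) `^ a)%:E).
    apply/funext => i; apply: integral_powR; rewrite harmonic_gt0/=.
    by rewrite /harmonic/= invf_lt1// ltr1n.
  apply: cvg_EFin; first by apply: nearW.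
  suff : (fun i => 1 - harmonic i.+1 `^ a) @ \oo --> (1 - 0 : R) by rewrite subr0.
  apply: cvgB; first exact: cvg_cst.
  have /cvg_at_rightP := powR_cvg0 a0.
  move=> /(_ (fun n => harmonic n.+1)); apply; split.
    by move=> n; exact: harmonic_gt0.
  by rewrite (cvg_shiftS (@harmonic R)); exact: cvg_harmonic.
suff E : (a%:E * kpconv 1 a 1 = 1)%E.
  have -> : (kpconv 1 a 1 = (a^-1)%:E * (a%:E * kpconv 1 a 1))%E.
    by rewrite muleA -EFinM mulVf ?gt_eqF// mul1e.
  by rewrite E mule1.
rewrite /kpconv -ge0_integralZl_EFin//; last 3 first.
- by move=> x _; rewrite lee_fin mulr_ge0 ?kp_ge0.
- by apply/measurable_EFinP; exact: measurable_kpconv_integrand.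
- exact: ltW.
have -> : (1%E = \int[mu]_(x in `]0%R, 1%R[) f x)%E.
  rewrite integral_itv_bndo_bndc; last exact: measurable_funTS.
  rewrite -I1; congr (integral _ _ _); apply/seteqP; split => x /=.
    move=> [n _]; rewrite /F/= !in_itv/= => /andP[nx ->]; rewrite andbT.
    by apply: lt_le_trans nx; exact: harmonic_gt0.
  rewrite in_itv/= => /andP[x0 x1].
  have [k] := ltr_add_invr x0; rewrite add0r => kx.
  exists k => //; rewrite /F/= in_itv/= x1 andbT; apply: le_trans (ltW kx).
  by rewrite lef_pV2 ?posrE ?ltr0n// ler_nat.
rewrite [RHS]integral_mkcond; apply: eq_integral => x _.
rewrite patchE -EFinM; case: ifPn; rewrite ?inE ?notin_setE/= in_itv/=.
  by move=> /andP[x0 x1]; rewrite kp1_gt0 ?subr_gt0// mul1r kp_gt0.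
move=> /negP; rewrite negb_and -!leNgt => /orP[x0|x1].
  by rewrite (kp_le0 a)// !mulr0.
by rewrite (kp_le0 1) ?mul0r ?mulr0// subr_le0.
Qed.

Local Open Scope ereal_scope.

(** The Beta identity at (1, a), where B(1, a) = 1 / a. Only real factors are cancelled, so infinite
    values are harmless. *)
Lemma egammaS (a : R) : (0 < a)%R -> egamma (a + 1) = a%:E * egamma a.
Proof.
move=> a0; have := egammaM 1 a ltr01 a0.
rewrite egamma1 mul1e (kpconv1 _ a0) addrC => ->.
by rewrite muleA -EFinM divff ?gt_eqF// mul1e.
Qed.

(** For a <= 1 the power x^(a-1) is at least 1 on []0, 1[] and at most 1 beyond. Hence the integrand
    is at least exp(-1) on the former, and is dominated by x^(a-1) there and by exp(-x) on the
    rest. *)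
Lemma egamma_fin01 (a : R) : (0 < a <= 1)%R -> 0 < egamma a < +oo.
Proof.
move=> /andP[a0 a1]; apply/andP; split.
- apply: (@lt_le_trans _ _ (expR (-1))%:E); first by rewrite lte_fin expR_gt0.
  have -> : (expR (-1))%:E = (expR (-1))%:E * kpconv 1 1 1 :> \bar R.
    by rewrite kpconv1// invr1 mule1.
  rewrite -kpconvZl ?expR_ge0//; apply: ge0_le_integral => //.
  + by move=> x _; rewrite lee_fin !mulr_ge0 ?kp_ge0 ?expR_ge0.
  + apply/measurable_EFinP; apply: measurable_funM; first exact: measurable_cst.
    exact: measurable_kpconv_integrand.
  + exact: measurable_egamma_integrand.
  + move=> x _; rewrite lee_fin; case: (ltP 0%R x) => x0; last first.
      by rewrite (kp_le0 1 x)// !mulr0 mulr_ge0 ?kp_ge0 ?expR_ge0.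
    case: (ltP x 1%R) => x1; last first.
      by rewrite (kp_le0 1 (1 - x)) ?subr_le0// !(mulr0, mul0r) mulr_ge0 ?kp_ge0 ?expR_ge0.
    rewrite !kp1_gt0 ?subr_gt0// !mulr1 kp_gt0//.
    rewrite -[leLHS]mul1r ler_pM ?expR_ge0//; last by rewrite ler_expR lerN2 ltW.
    rewrite -[leLHS](powRr0 x) ger_powR ?subr_le0//.
    by rewrite x0 ltW.
- apply: (@le_lt_trans _ _ (kpconv 1 a 1 + egamma 1)); last first.
    by rewrite kpconv1// egamma1 -EFinD ltry.
  rewrite /egamma /kpconv -ge0_integralD//; last 4 first.
  + by move=> x _; rewrite lee_fin !mulr_ge0 ?kp_ge0.
  + by apply/measurable_EFinP; exact: measurable_kpconv_integrand.
  + by move=> x _; rewrite lee_fin !mulr_ge0 ?kp_ge0 ?expR_ge0.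
  + exact: measurable_egamma_integrand.
  apply: ge0_le_integral => //.
  + by move=> x _; rewrite lee_fin !mulr_ge0 ?kp_ge0 ?expR_ge0.
  + exact: measurable_egamma_integrand.
  + apply: emeasurable_funD; last exact: measurable_egamma_integrand.
    by apply/measurable_EFinP; exact: measurable_kpconv_integrand.
  + move=> x _; rewrite -EFinD lee_fin; case: (ltP 0%R x) => x0; last first.
      by rewrite !(kp_le0 _ x)// !(mulr0, mul0r) addr0.
    case: (ltP x 1%R) => x1.
      rewrite kp1_gt0 ?subr_gt0// mul1r ler_wpDr//.
        by rewrite mulr_ge0 ?kp_ge0 ?expR_ge0.
      rewrite ler_piMr ?kp_ge0// -expR0 ler_expR; lra.
    rewrite ler_wpDl ?mulr_ge0 ?kp_ge0// ler_wpM2r ?expR_ge0//.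
    by rewrite kp1_gt0// kp_gt0// -[leRHS](powRr0 x) ler_powR// subr_le0.
Qed.

Lemma egamma_gt0_lty (a : R) : (0 < a)%R -> 0 < egamma a < +oo.
Proof.
(* Induction on an integer bound for [a]: the recurrence lowers [a] by 1 until it lies in []0,
   1]]. *)
move=> a0; have [n an] : exists n, (a <= n.+1%:R)%R.
  by exists (Num.truncn a); exact/ltW/truncnS_gt.
elim: n a a0 an => [|n IH] a a0 an; first by apply: egamma_fin01; rewrite a0.
have [a1|a1] := leP a 1%R; first by apply: egamma_fin01; rewrite a0.
have a10 : (0 < a - 1)%R by rewrite subr_gt0.
have /andP[g0 goo] : 0 < egamma (a - 1) < +oo.
  by apply: IH => //; rewrite lerBlDr natr1.
rewrite -(subrK 1%R a) egammaS//; apply/andP; split.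
  by rewrite mule_gt0// lte_fin.
by rewrite lte_mul_pinfty// ?lee_fin// ltW.
Qed.

Lemma egammaE (a : R) : (0 < a)%R -> egamma a = (Gamma a)%:E.
Proof.
move=> a0; have /andP[g0 goo] := egamma_gt0_lty a a0.
by rewrite GammaE fineK// ge0_fin_numE// ltW.
Qed.

Lemma Gamma_gt0 (a : R) : (0 < a)%R -> (0 < Gamma a)%R.
Proof.
move=> a0; have /andP[+ _] := egamma_gt0_lty a a0.
by rewrite egammaE// lte_fin.
Qed.

Lemma Gamma1 : Gamma (1 : R) = 1%R.
Proof. by rewrite GammaE egamma1. Qed.

Lemma GammaS (a : R) : (0 < a)%R -> Gamma (a + 1) = (a * Gamma a)%R.
Proof. by move=> a0; rewrite !GammaE egammaS// egammaE. Qed.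

(** Here B(a, b) gets its closed form: [Gamma (a + b)] is now known to be finite and positive, so it
    can be divided out. *)
Lemma kpconvE (a b t : R) : (0 < a)%R -> (0 < b)%R ->
  kpconv a b t = (Gamma a * Gamma b / Gamma (a + b) * kp (a + b) t)%:E.
Proof.
move=> a0 b0; have ab0 : (0 < a + b)%R by rewrite addr_gt0.
rewrite kpconv_scale// muleC [RHS]EFinM; congr (_ * _).
have := egammaM a b a0 b0; rewrite !egammaE// => E.
have g0 := Gamma_gt0 _ ab0.
have : kpconv a b 1 * (Gamma (a + b))%:E * ((Gamma (a + b))^-1)%:E = kpconv a b 1.
  by rewrite -muleA -EFinM divff ?gt_eqF// mule1.
by move=> <-; rewrite -E -!EFinM.
Qed.
End GammaValues.

(** * Riemann-Liouville integrals in the new variable *)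

Section RLIntegral.
Context {R : realType}.
Local Notation mu := (@lebesgue_measure R).

Definition RL (a : R) (w : R -> R) (t : R) : R :=
  (Gamma a)^-1 * (\int[mu]_v (kp a (t - v) * (kp 1 v * w v)))%R.

Lemma measurable_RL_integrand (a t : R) (w : R -> R) :
  measurable_fun setT w ->
  measurable_fun setT (fun v : R => kp a (t - v) * (kp 1 v * w v)).
Proof.
move=> mw; apply: measurable_funM.
  by apply: measurable_kpD; apply: measurable_funB => //; exact: measurable_cst.
by apply: measurable_funM => //; exact: measurable_kp.
Qed.

Lemma le_RL_integrand (a t M : R) (w : R -> R) (v : R) :
  (forall v, 0 < v < t -> `|w v| <= M) ->
  `|kp a (t - v) * (kp 1 v * w v)| <= M * (kp a (t - v) * kp 1 v).
Proof.
move=> wM; rewrite 2!normrM !(ger0_norm (kp_ge0 _ _)).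
have [v0|v0] := leP v 0; first by rewrite (kp_le0 1 v)// !(mul0r, mulr0).
have [tv|tv] := leP t v; first by rewrite (kp_le0 a) ?subr_le0// !(mul0r, mulr0).
rewrite [leLHS](_ : _ = `|w v| * (kp a (t - v) * kp 1 v)); last by ring.
apply: ler_wpM2r; first by rewrite mulr_ge0 ?kp_ge0.
by apply: wM; rewrite v0.
Qed.

Lemma kpconv_integrable (a b t : R) : 0 < a -> 0 < b ->
  mu.-integrable setT (fun v => (kp a (t - v) * kp b v)%:E).
Proof.
move=> a0 b0; apply/integrableP; split.
  by apply/measurable_EFinP; exact: measurable_kpconv_integrand.
have -> : (\int[mu]_x `|(kp a (t - x) * kp b x)%:E| = kpconv a b t)%E.
  by apply: eq_integral => x _; rewrite gee0_abs// lee_fin mulr_ge0 ?kp_ge0.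
by rewrite kpconvE// ltry.
Qed.

Lemma RL_integrable (a t M : R) (w : R -> R) : 0 < a ->
  measurable_fun setT w -> (forall v, 0 < v < t -> `|w v| <= M) ->
  mu.-integrable setT (fun v => (kp a (t - v) * (kp 1 v * w v))%:E).
Proof.
move=> a0 mw wM.
apply: (@le_integrable _ _ R mu setT measurableT _
  (fun v => (M%:E * (kp a (t - v) * kp 1 v)%:E)%E)).
- by apply/measurable_EFinP; exact: measurable_RL_integrand.
- move=> v _; rewrite -EFinM !abse_EFin lee_fin.
  exact: le_trans (le_RL_integrand _ _ _ _ _ wM) (ler_norm _).
- by apply: integrableZl => //; apply: kpconv_integrable.
Qed.

Lemma continuous_bounded_itv (w : R -> R) (s t : R) : continuous w ->
  exists M, 0 <= M /\ forall v, s <= v <= t -> `|w v| <= M.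
Proof.
move=> cw; have [st|st] := leP s t; last first.
  exists 0; split => // v /andP[sv vt].
  by move: (le_lt_trans (le_trans sv vt) st); rewrite ltxx.
have cn : {within `[s, t], continuous (fun v => `|w v|)}.
  apply: continuous_subspaceT => v.
  by apply: cvg_norm; exact: cw.
have [c _ cM] := EVT_max st cn.
exists `|w c|; split => // v vst; apply: cM; by rewrite in_itv.
Qed.

Lemma RL_integrable_continuous (a t : R) (w : R -> R) : 0 < a ->
  continuous w ->
  mu.-integrable setT (fun v => (kp a (t - v) * (kp 1 v * w v))%:E).
Proof.
move=> a0 cw; have [M [_ wM]] := continuous_bounded_itv w 0 t cw.
apply: (@RL_integrable _ _ M) => //; first exact: continuous_measurable_fun.
by move=> v /andP[v0 vt]; apply: wM; rewrite !ltW.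
Qed.

Lemma RL_le0 (a t : R) (w : R -> R) : t <= 0 -> RL a w t = 0.
Proof.
move=> t0; rewrite /RL /Rintegral integral0_eq ?mulr0// => v _.
have [v0|v0] := leP v 0; first by rewrite (kp_le0 1 v)// mul0r mulr0.
by rewrite kp_le0 ?mul0r// subr_le0; exact: le_trans (ltW v0).
Qed.

Lemma eq_RL (a t : R) (w1 w2 : R -> R) :
  (forall v, 0 < v < t -> w1 v = w2 v) -> RL a w1 t = RL a w2 t.
Proof.
move=> E; rewrite /RL; congr (_ * _); apply: eq_Rintegral => v _.
have [v0|v0] := leP v 0; first by rewrite (kp_le0 1 v)// !mul0r.
have [tv|tv] := leP t v; first by rewrite (kp_le0 a) ?subr_le0// !mul0r.
by rewrite E// v0.
Qed.

Lemma RLB (a t : R) (w1 w2 : R -> R) :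
  mu.-integrable setT (fun v => (kp a (t - v) * (kp 1 v * w1 v))%:E) ->
  mu.-integrable setT (fun v => (kp a (t - v) * (kp 1 v * w2 v))%:E) ->
  RL a (fun v => w1 v - w2 v) t = RL a w1 t - RL a w2 t.
Proof.
move=> i1 i2; rewrite /RL -mulrBr -RintegralB//; congr (_ * _).
by apply: eq_Rintegral => v _; rewrite !mulrBr.
Qed.

(** The right side is the fractional integral of the constant [M]; it is the source of the factors 1
    / Gamma(alpha + 1) and 1 / Gamma(beta + 1) in the contraction constants. As [M] bounds [w] on
    []0, t[] only, it may depend on [t], which yields sharper orders of vanishing at 0. *)
Lemma RL_bound (a t M : R) (w : R -> R) : 0 < a -> 0 <= t ->
  measurable_fun setT w -> (forall v, 0 < v < t -> `|w v| <= M) ->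
  `|RL a w t| <= M * t `^ a / Gamma (a + 1).
Proof.
move=> a0 t0 mw wM.
have [t0'|t_gt0] := leP t 0.
  have -> : t = 0 by apply/eqP; rewrite eq_le t0 t0'.
  by rewrite RL_le0// normr0 powR0 ?gt_eqF// mulr0 mul0r.
have iw := RL_integrable a t M w a0 mw wM.
rewrite /RL normrM ger0_norm ?invr_ge0 ?(ltW (Gamma_gt0 _ a0))//.
have -> : M * t `^ a / Gamma (a + 1)
    = (Gamma a)^-1 * (M * fine (kpconv a 1 t)).
  rewrite kpconvE//= Gamma1 mulr1 kp_gt0// addrK.
  have g0 := Gamma_gt0 _ a0; have g1 : 0 < Gamma (a + 1) by rewrite Gamma_gt0 ?addr_gt0.
  move: (Gamma a) (Gamma (a + 1)) (t `^ a) g0 g1 => x y z x0 y0.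
  by field; rewrite !gt_eqF.
rewrite ler_pM2l ?invr_gt0 ?Gamma_gt0//.
apply: le_trans (le_normr_Rintegral _ iw) _ => //.
rewrite /kpconv -/(Rintegral _ _ _) -RintegralZl//; last exact: kpconv_integrable.
apply: le_Rintegral => //.
- exact: integrable_norm.
- have := @integrableZl _ _ _ mu setT measurableT M _ (kpconv_integrable a 1 t a0 ltr01).
  by under eq_fun do rewrite -EFinM.
- by move=> v _; exact: le_RL_integrand.
Qed.
End RLIntegral.

(** * The semigroup law *)

Section RLSemigroup.
Context {R : realType}.
Local Notation mu := (@lebesgue_measure R).
Local Open Scope ereal_scope.

Lemma kpconv_shift (a b s t : R) :
  \int[mu]_u (kp a (t - u) * kp b (u - s))%:E = kpconv a b (t - s).
Proof.
rewrite /kpconv (@integral_translate R (fun u => (kp a (t - s - u) * kp b u)%:E) s).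
- by apply: eq_integral => u _; rewrite opprB addrA subrK.
- by apply/measurable_EFinP; exact: measurable_kpconv_integrand.
- by move=> u; rewrite lee_fin mulr_ge0 ?kp_ge0.
Qed.

Lemma measurable_kp_shift (a b s t : R) :
  measurable_fun setT (fun u : R => (kp a (t - u) * kp b (u - s))%R).
Proof.
apply: measurable_funM; apply: measurable_kpD; apply: measurable_funB => //;
  exact: measurable_cst.
Qed.

Lemma kp_shift_integrable (a b s t : R) : (0 < a)%R -> (0 < b)%R ->
  mu.-integrable setT (fun u => (kp a (t - u) * kp b (u - s))%:E).
Proof.
move=> a0 b0; apply/integrableP; split.
  by apply/measurable_EFinP; exact: measurable_kp_shift.
suff -> : \int[mu]_x `|(kp a (t - x) * kp b (x - s))%:E| = kpconv a b (t - s).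
  by rewrite kpconvE// ltry.
by rewrite -kpconv_shift; apply: eq_integral => x _; rewrite gee0_abs// lee_fin mulr_ge0 ?kp_ge0.
Qed.

Lemma integral_RL_outer (a b s t c : R) : (0 < a)%R -> (0 < b)%R ->
  \int[mu]_u (kp a (t - u) * (kp b (u - s) * c))%:E =
  (Gamma a * Gamma b / Gamma (a + b) * (kp (a + b) (t - s) * c))%:E.
Proof.
move=> a0 b0.
transitivity (\int[mu]_u (c%:E * (kp a (t - u) * kp b (u - s))%:E)).
  by apply: eq_integral => u _; rewrite -EFinM; congr EFin; ring.
rewrite integralZl//; last exact: kp_shift_integrable.
rewrite kpconv_shift kpconvE// -EFinM; congr EFin.
move: (Gamma a) (Gamma b) (Gamma (a + b)) => x y z; ring.
Qed.

Lemma integral_RL_inner (a b t u M : R) (w : R -> R) : (0 < b)%R ->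
  measurable_fun setT w -> (forall v, (0 < v < t)%R -> (`|w v| <= M)%R) ->
  \int[mu]_v (kp a (t - u) * (kp b (u - v) * (kp 1 v * w v)))%:E =
  (Gamma b * (kp a (t - u) * (kp 1 u * RL b w u)))%:E.
Proof.
move=> b0 mw wM; have [tu|ut] := leP t u.
  rewrite (kp_le0 a) ?subr_le0// mul0r mulr0.
  by rewrite integral0_eq// => v _; rewrite mul0r.
have iw : mu.-integrable setT (fun v => (kp b (u - v) * (kp 1 v * w v))%:E).
  apply: (RL_integrable b u M) => // v /andP[v0 vu].
  by apply: wM; rewrite v0 (lt_trans vu).
transitivity (\int[mu]_v ((kp a (t - u))%:E * (kp b (u - v) * (kp 1 v * w v))%:E)).
  by apply: eq_integral => v _; rewrite -EFinM.
rewrite integralZl// -(fineK (integrable_fin_num measurableT iw)) -EFinM.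
congr EFin.
have -> : (fine (\int[mu]_x (kp b (u - x) * (kp 1 x * w x))%:E) = Gamma b * RL b w u)%R.
  by rewrite /RL mulrA mulfV ?mul1r// gt_eqF ?Gamma_gt0.
have [u0|u0] := leP u 0%R; first by rewrite RL_le0// !mulr0.
by rewrite kp1_gt0// mul1r; ring.
Qed.

Definition RLkernel (a b t : R) (w : R -> R) (z : R * R) : \bar R :=
  (kp a (t - z.1) * (kp b (z.1 - z.2) * (kp 1 z.2 * w z.2)))%:E.

Lemma measurable_RLkernel (a b t : R) (w : R -> R) :
  measurable_fun setT w -> measurable_fun setT (RLkernel a b t w).
Proof.
move=> mw; apply/measurable_EFinP; apply: measurable_funM.
  apply: measurable_kpD; apply: measurable_funB; first exact: measurable_cst.
  exact: measurable_fst.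
apply: measurable_funM.
  apply: measurable_kpD; apply: measurable_funB; first exact: measurable_fst.
  exact: measurable_snd.
apply: measurable_funM; first by apply: measurable_kpD; exact: measurable_snd.
exact: (measurableT_comp mw measurable_snd).
Qed.

(** Tonelli, integrating the absolute value first in the outer variable: this leaves a multiple of
    the kernel of order a + b against [|w|], which is integrable. *)
Lemma RLkernel_integrable (a b t M : R) (w : R -> R) : (0 < a)%R -> (0 < b)%R ->
  measurable_fun setT w -> (forall v, (0 < v < t)%R -> (`|w v| <= M)%R) ->
  (mu \x mu).-integrable setT (RLkernel a b t w).
Proof.
move=> a0 b0 mw wM.
apply/(integrable21ltyP mu mu).
  exact: measurable_RLkernel.
have -> : \int[mu]_y \int[mu]_x `|RLkernel a b t w (x, y)| =
    \int[mu]_y (Gamma a * Gamma b / Gamma (a + b) *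
      (kp (a + b) (t - y) * (kp 1 y * `|w y|)))%:E.
  apply: eq_integral => y _; move: (y : R) => {}y.
  rewrite -integral_RL_outer//; apply: eq_integral => x _.
  rewrite /RLkernel/= !normrM; congr EFin.
  by rewrite !(ger0_norm (kp_ge0 _ _)).
have iw : mu.-integrable setT (fun v => (kp (a + b) (t - v) * (kp 1 v * `|w v|))%:E).
  apply: (RL_integrable _ _ M); first by rewrite addr_gt0.
    exact: measurableT_comp.
  by move=> v /wM; rewrite normr_id.
under eq_integral do rewrite EFinM.
rewrite integralZl//.
by rewrite -(fineK (integrable_fin_num measurableT iw)) -EFinM ltry.
Qed.

(** Fubini for the double kernel: one order of integration produces [RL b w], the other the Beta
    constant. The integrability of [RL b w] against the kernel is recorded too, since Fubini
    delivers it without a separate study of the measurability of [RL b w]. *)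
Lemma RL_semigroup (a b t M : R) (w : R -> R) : (0 < a)%R -> (0 < b)%R ->
  measurable_fun setT w -> (forall v, (0 < v < t)%R -> (`|w v| <= M)%R) ->
  mu.-integrable setT (fun u => (kp a (t - u) * (kp 1 u * RL b w u))%:E) /\
  RL a (RL b w) t = RL (a + b) w t.
Proof.
move=> a0 b0 mw wM.
have ik := RLkernel_integrable a b t M w a0 b0 mw wM.
have gb0 := Gamma_gt0 b b0; have ga0 := Gamma_gt0 a a0.
have gab0 : (0 < Gamma (a + b))%R by rewrite Gamma_gt0// addr_gt0.
have FE u : \int[mu]_v RLkernel a b t w (u, v) =
    (Gamma b)%:E * (kp a (t - u) * (kp 1 u * RL b w u))%:E.
  by rewrite -EFinM -(integral_RL_inner a b t u M w b0 mw wM).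
have GE v : \int[mu]_u RLkernel a b t w (u, v) =
    (Gamma a * Gamma b / Gamma (a + b))%:E *
    (kp (a + b) (t - v) * (kp 1 v * w v))%:E.
  by rewrite -EFinM -(integral_RL_outer a b v t (kp 1 v * w v)%R a0 b0).
have iF : mu.-integrable setT (fun u => (kp a (t - u) * (kp 1 u * RL b w u))%:E).
  have := @integrableZl _ _ _ mu setT measurableT (Gamma b)^-1 _ (integrable_fubini_F ik).
  apply: eq_integrable => // u _.
  transitivity ((Gamma b)^-1%:E * \int[mu]_v RLkernel a b t w (u, v)); first by [].
  by rewrite FE -!EFinM mulrA mulVf ?gt_eqF// mul1r.
split => //.
have iw : mu.-integrable setT (fun v => (kp (a + b) (t - v) * (kp 1 v * w v))%:E).
  by apply: (RL_integrable _ _ M) => //; rewrite addr_gt0.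
have : \int[mu]_u ((Gamma b)%:E * (kp a (t - u) * (kp 1 u * RL b w u))%:E) =
    \int[mu]_v ((Gamma a * Gamma b / Gamma (a + b))%:E *
      (kp (a + b) (t - v) * (kp 1 v * w v))%:E).
  transitivity (\int[mu]_u \int[mu]_v RLkernel a b t w (u, v)).
    by apply: eq_integral => u _; rewrite FE.
  apply: (eq_trans (Fubini ik)).
  by apply: eq_integral => v _; rewrite -GE.
rewrite integralZl// integralZl//.
rewrite -(fineK (integrable_fin_num measurableT iF)).
rewrite -(fineK (integrable_fin_num measurableT iw)) -!EFinM => -[].
rewrite /RL /Rintegral /=.
move: (fine _) (fine _) => y x E.
have -> : (x = (Gamma b)^-1 * (Gamma b * x))%R by rewrite mulrA mulVf ?gt_eqF// mul1r.
rewrite E; move: (Gamma a) (Gamma b) (Gamma (a + b)) ga0 gb0 gab0 => p q r p0 q0 r0.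
by field; rewrite !gt_eqF.
Qed.
End RLSemigroup.

(** * Order one as a primitive; continuity of fractional integrals *)

Section RLPrimitive.
Context {R : realType}.
Local Notation mu := (@lebesgue_measure R).

Lemma RL1E (g : R -> R) (t : R) :
  RL 1 g t = (\int[mu]_v (kp 1 (t - v) * (kp 1 v * g v)))%R.
Proof. by rewrite /RL Gamma1 invr1 mul1r. Qed.

Lemma RL1_integrable_le (g : R -> R) (t T : R) : t <= T ->
  mu.-integrable setT (fun v => (kp 1 (T - v) * (kp 1 v * g v))%:E) ->
  mu.-integrable setT (fun v => (kp 1 (t - v) * (kp 1 v * g v))%:E).
Proof.
move=> tT iT.
have E v : kp 1 (t - v) * (kp 1 v * g v) =
    kp 1 (t - v) * (kp 1 (T - v) * (kp 1 v * g v)).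
  have [tv|vt] := leP t v; first by rewrite (kp_le0 1 (t - v)) ?subr_le0// !mul0r.
  by rewrite (kp1_gt0 (T - v)) ?mul1r// subr_gt0; exact: lt_le_trans tT.
apply: (@le_integrable _ _ R mu setT measurableT _
  (fun v => (kp 1 (T - v) * (kp 1 v * g v))%:E)) => //.
- under eq_fun do rewrite E; apply/measurable_EFinP; apply: measurable_funM.
    by apply: measurable_kpD; apply: measurable_funB => //; exact: measurable_cst.
  by apply/measurable_EFinP; exact: measurable_int iT.
- move=> v _; rewrite E !abse_EFin lee_fin normrM ger0_norm ?kp_ge0//.
  by rewrite -[leRHS]mul1r ler_wpM2r ?kp1_le1.
Qed.

Lemma RL1_lipschitz (g : R -> R) (M s t : R) : s <= t -> 0 <= M ->
  mu.-integrable setT (fun v => (kp 1 (t - v) * (kp 1 v * g v))%:E) ->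
  (forall v, 0 < v -> s <= v < t -> `|g v| <= M) ->
  `|RL 1 g t - RL 1 g s| <= M * (t - s).
Proof.
move=> st M0 it gM; have is_ := RL1_integrable_le g s t st it.
rewrite !RL1E -RintegralB//.
have iD := integrableB measurableT it is_.
apply: le_trans (le_normr_Rintegral _ _) _ => //.
have iI : mu.-integrable setT (EFin \o (\1_(`[s, t]%classic) : R -> R)).
  exact: integrable_indic_itv.
have -> : M * (t - s) = \int[mu]_v (M * \1_(`[s, t]%classic) v).
  rewrite RintegralZl//; congr (_ * _).
  rewrite /Rintegral integral_indic//= setIT lebesgue_measure_itv/= lte_fin.
  by case: ltP => // ts; apply/eqP; rewrite subr_eq0 eq_le ts.
apply: le_Rintegral => //.
- exact: integrable_norm.
- have := @integrableZl _ _ _ mu setT measurableT M _ iI.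
  by under eq_fun do rewrite -EFinM.
move=> v _; rewrite -mulrBl normrM indicE.
have [v0|v0] := leP v 0.
  by rewrite (kp_le0 1 v)// mul0r normr0 mulr0 mulr_ge0.
rewrite (kp1_gt0 v)// mul1r.
have [tv|vt] := leP t v.
  rewrite !kp_le0 ?subr_le0//; last exact: le_trans tv.
  by rewrite subrr normr0 mul0r mulr_ge0.
rewrite (kp1_gt0 (t - v)) ?subr_gt0//.
have [sv|vs] := leP s v.
  rewrite kp_le0 ?subr_le0// subr0 normr1 mul1r mem_set/= ?in_itv/= ?sv ?(ltW vt)//.
  by rewrite mulr1 gM// sv.
by rewrite kp1_gt0 ?subr_gt0// subrr normr0 mul0r mulr_ge0.
Qed.

(** Local boundedness replaces continuity of [g], because the lemma is meant for [g] =
    [RL (a - 1) w], for which only a bound and integrability are at hand. *)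
Lemma RL1_continuous (g : R -> R) :
  (forall T, exists M, [/\ 0 <= M, forall v, 0 < v < T -> `|g v| <= M &
    mu.-integrable setT (fun v => (kp 1 (T - v) * (kp 1 v * g v))%:E)]) ->
  continuous (RL 1 g).
Proof.
move=> gP t; have [M [M0 gM iT]] := gP (t + 1).
apply/(@cvgrPdist_le _ R^o) => e e0.
near=> s.
have st1 : s <= t + 1.
  suff : `|t - s| <= 1 by rewrite ler_norml => /andP[]; lra.
  by near: s; apply: cvgr_dist_le; [exact: cvg_id|exact: ltr01].
have d : `|t - s| <= e / (M + 1).
  near: s; apply: cvgr_dist_le; first exact: cvg_id.
  by rewrite divr_gt0// ltr_wpDl.
apply: (@le_trans _ _ (M * `|t - s|)); last first.
  apply: le_trans (ler_wpM2l M0 d) _.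
  rewrite mulrCA ler_piMr ?(ltW e0)// ler_pdivrMr ?mul1r ?lerDl//.
  by rewrite ltr_wpDl.
have [ts|st] := leP t s.
  rewrite distrC [`|t - s|]distrC (ger0_norm (_ : 0 <= s - t)) ?subr_ge0//.
  apply: RL1_lipschitz => //; first exact: (RL1_integrable_le _ _ _ st1 iT).
  move=> v v0 /andP[_ vs]; apply: gM; rewrite v0; exact: lt_le_trans st1.
rewrite (ger0_norm (_ : 0 <= t - s)) ?subr_ge0 ?(ltW st)//.
have t1 : t <= t + 1 by rewrite lerDl.
apply: RL1_lipschitz => //; [exact: ltW|exact: (RL1_integrable_le _ _ _ t1 iT)|].
move=> v v0 /andP[_ vt]; apply: gM; rewrite v0; exact: lt_le_trans t1.
Unshelve. all: by end_near. Qed.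

Lemma continuous_RL1 (w : R -> R) : continuous w -> continuous (RL 1 w).
Proof.
move=> cw; apply: RL1_continuous => T.
have [M [M0 wM]] := continuous_bounded_itv w 0 T cw.
exists M; split => //; last exact: RL_integrable_continuous.
by move=> v /andP[v0 vT]; apply: wM; rewrite !ltW.
Qed.

Lemma RL_semigroup_continuous (a b t : R) (w : R -> R) : 0 < a -> 0 < b ->
  continuous w ->
  mu.-integrable setT (fun u => (kp a (t - u) * (kp 1 u * RL b w u))%:E) /\
  RL a (RL b w) t = RL (a + b) w t.
Proof.
move=> a0 b0 cw; have [M [_ wM]] := continuous_bounded_itv w 0 t cw.
apply: (RL_semigroup a b t M) => //; first exact: continuous_measurable_fun.
by move=> v /andP[v0 vt]; apply: wM; rewrite !ltW.
Qed.

(** By the semigroup law [RL a w] is a primitive of [RL (a - 1) w], which [RL_bound] controls; the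
    kernel of order [a] is never estimated directly. *)
Lemma continuous_RL (a : R) (w : R -> R) : 1 < a -> continuous w ->
  continuous (RL a w).
Proof.
move=> a1 cw; have b0 : 0 < a - 1 by rewrite subr_gt0.
have -> : RL a w = RL 1 (RL (a - 1) w).
  apply/funext => t; have [_ ->] := RL_semigroup_continuous 1 _ t w ltr01 b0 cw.
  by rewrite addrC subrK.
apply: RL1_continuous => T.
have [M [M0 wM]] := continuous_bounded_itv w 0 T cw.
have g0 : 0 < Gamma (a - 1 + 1) by rewrite Gamma_gt0// subrK; exact: lt_trans a1.
exists (M * T `^ (a - 1) / Gamma (a - 1 + 1)); split.
- by rewrite divr_ge0 ?mulr_ge0 ?powR_ge0// ltW.
- move=> v /andP[v0 vT]; apply: (@le_trans _ _ (M * v `^ (a - 1) / Gamma (a - 1 + 1))).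
    apply: RL_bound => //; [exact: ltW|exact: continuous_measurable_fun|].
    by move=> u /andP[u0 uv]; apply: wM; rewrite ltW//= ltW// (lt_trans uv).
  rewrite ler_pM2r ?invr_gt0// ler_wpM2l// ge0_ler_powR ?nnegrE ?ltW//.
  exact: lt_trans vT.
- by have [] := RL_semigroup_continuous 1 _ T w ltr01 b0 cw.
Qed.

Lemma RL1_cst (c t : R) : 0 <= t -> RL 1 (fun=> c) t = c * t.
Proof.
move=> t0; rewrite RL1E.
transitivity (\int[mu]_v (c * (kp 1 (t - v) * kp 1 v))).
  by apply: eq_Rintegral => v _; ring.
rewrite RintegralZl//; last exact: kpconv_integrable.
congr (_ * _); transitivity (fine (kpconv 1 1 t)); first by [].
rewrite kpconvE//= GammaS// Gamma1 !mulr1 mul1r invr1 mul1r.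
move: t0; rewrite le_eqVlt => /predU1P[<-|t0]; first by rewrite kp_le0.
by rewrite kp_gt0// addrK powRr1// ltW.
Qed.

(** Quantitative fundamental theorem of calculus: with [c] the value of [w] at a point and [e] its
    oscillation nearby, [c] is the slope of the primitive up to [e]. It follows from the Lipschitz
    bound applied to w - c. *)
Lemma RL1_increment (w : R -> R) (c e s t : R) : continuous w ->
  0 <= s -> s <= t -> 0 <= e -> (forall v, s <= v <= t -> `|w v - c| <= e) ->
  `|RL 1 w t - RL 1 w s - c * (t - s)| <= e * (t - s).
Proof.
move=> cw s0 st e0 we.
have cwc : continuous (fun v => w v - c).
  by move=> v; apply: cvgB; [exact: cw|exact: cvg_cst].
have cc : continuous (fun _ : R => c) by move=> v; exact: cvg_cst.
have E u : 0 <= u -> RL 1 (fun v => w v - c) u = RL 1 w u - c * u.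
  by move=> u0; rewrite RLB ?RL1_cst//; exact: RL_integrable_continuous.
have := RL1_lipschitz (fun v => w v - c) e s t st e0.
rewrite !E//; last exact: le_trans st.
have -> : RL 1 w t - c * t - (RL 1 w s - c * s) = RL 1 w t - RL 1 w s - c * (t - s).
  by move: (RL 1 w t) (RL 1 w s) => x y; ring.
apply; first exact: RL_integrable_continuous.
by move=> v v0 /andP[sv vt]; apply: we; rewrite sv ltW.
Qed.
End RLPrimitive.

(** * Derivatives relative to the unit interval *)

Section UnitIntervalDerivative.
Context {R : realType}.
Implicit Types (s : R -> R) (t l : R).

Definition is_deriv01 s t l := diffquot01 s t --> l.

Lemma is_deriv01P s t l : is_deriv01 s t l <->
  forall e, 0 < e -> exists2 d, 0 < d & forall u, 0 <= u <= 1 -> u != t ->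
    `|u - t| < d -> `|(s u - s t) / (u - t) - l| <= e.
Proof.
split.
- move=> /cvgrPdist_le H e e0; have := H e e0.
  rewrite nearE => /nbhs_ballP[d/= d0 dP]; exists d => // u u01 ut utd.
  rewrite distrC; apply: dP => //=.
  by rewrite /ball/= distrC.
- move=> H; apply/cvgrPdist_le => e e0; have [d d0 dP] := H e e0.
  rewrite nearE; apply/nbhs_ballP; exists d => // u/=.
  rewrite /ball/= distrC => utd ut; rewrite in_itv/= => u01.
  by rewrite distrC; exact: dP.
Qed.

Lemma continuous01P s : {within `[0, 1], continuous s} <->
  forall t, 0 <= t <= 1 -> forall e, 0 < e -> exists2 d, 0 < d &
    forall u, 0 <= u <= 1 -> `|u - t| < d -> `|s u - s t| <= e.
Proof.
split.
- move=> /subspace_continuousP H t t01 e e0.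
  have /cvgrPdist_le/(_ e e0) : s x @[x --> within `[0, 1] (nbhs t)] --> s t.
    by apply: H; rewrite /= in_itv.
  rewrite nearE => /nbhs_ballP[d/= d0 dP]; exists d => // u u01 utd.
  by rewrite distrC; apply: dP => /=; rewrite ?in_itv// /ball/= distrC.
- move=> H; apply/subspace_continuousP => t; rewrite /= in_itv/= => t01.
  apply/cvgrPdist_le => e e0; have [d d0 dP] := H t t01 e e0.
  rewrite nearE; apply/nbhs_ballP; exists d => // u/=.
  by rewrite /ball/= distrC in_itv/= => utd u01; rewrite distrC; exact: dP.
Qed.

(** Every point of [0,1] is an accumulation point of [0,1], which is what makes relative derivatives
    unique. The nearby point is taken to the right, except at t = 1. *)
Lemma near01 t d : 0 <= t <= 1 -> 0 < d ->
  exists u, [/\ 0 <= u <= 1, u != t & `|u - t| < d].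
Proof.
move=> /andP[t0 t1] d0; have [tl|tl] := ltP t 1.
- pose m := Num.min (d / 2) (1 - t).
  have m0 : 0 < m by rewrite lt_min subr_gt0 tl divr_gt0.
  have m1 : m <= 1 - t by rewrite ge_min lexx orbT.
  have m2 : m <= d / 2 by rewrite ge_min lexx.
  exists (t + m); split; first by apply/andP; split; lra.
    by rewrite gt_eqF// ltrDl.
  by rewrite addrC addKr gtr0_norm//; lra.
- pose m := Num.min (d / 2) 1.
  have m0 : 0 < m by rewrite lt_min ltr01 divr_gt0.
  have m1 : m <= 1 by rewrite ge_min lexx orbT.
  have m2 : m <= d / 2 by rewrite ge_min lexx.
  exists (t - m); split; first by apply/andP; split; lra.
    by rewrite lt_eqF// ltrBlDr ltrDl.
  by rewrite addrC addKr normrN gtr0_norm//; lra.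
Qed.

Lemma is_deriv01_unique s t l1 l2 : 0 <= t <= 1 ->
  is_deriv01 s t l1 -> is_deriv01 s t l2 -> l1 = l2.
Proof.
move=> t01 /is_deriv01P H1 /is_deriv01P H2; apply/eqP; rewrite -subr_eq0 -normr_le0.
apply/ler_addgt0Pr => e e0; rewrite add0r.
have [d1 d10 dP1] := H1 (e / 2) (divr_gt0 e0 (ltr0Sn R 1)).
have [d2 d20 dP2] := H2 (e / 2) (divr_gt0 e0 (ltr0Sn R 1)).
have d0 : 0 < Num.min d1 d2 by rewrite lt_min d10.
have [u [u01 ut]] := near01 t _ t01 d0; rewrite lt_min => /andP[ud1 ud2].
have := dP1 u u01 ut ud1; have := dP2 u u01 ut ud2.
set q := _ / _; rewrite -[l1 - l2](subrKA q) => h2 h1.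
apply: le_trans (ler_normD _ _) _; rewrite [e]splitr.
by apply: lerD => //; rewrite distrC.
Qed.

Lemma derivable01P s t : derivable01 s t -> is_deriv01 s t (deriv01 s t).
Proof. by []. Qed.

Lemma near01_proper t : 0 <= t <= 1 -> ProperFilter (within `[0, 1] t^').
Proof.
move=> t01; apply: Build_ProperFilter_ex => P; rewrite /within/= => /nbhs_ballP[d/= d0 dP].
have [u [u01 ut utd]] := near01 t d t01 d0.
exists u; apply: dP => //=.
by rewrite /ball/= distrC.
Qed.

Lemma is_deriv01_deriv s t l : 0 <= t <= 1 ->
  is_deriv01 s t l -> derivable01 s t /\ deriv01 s t = l.
Proof.
move=> t01 H; have PF := near01_proper t t01; split; first by apply/cvg_ex; exists l.
apply: (is_deriv01_unique s t) => //; apply: derivable01P.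
by apply/cvg_ex; exists l.
Qed.

Lemma eq_is_deriv01 s1 s2 t l : 0 <= t <= 1 ->
  (forall u, 0 <= u <= 1 -> s1 u = s2 u) ->
  is_deriv01 s1 t l -> is_deriv01 s2 t l.
Proof.
move=> t01 E /is_deriv01P H; apply/is_deriv01P => e /H[d d0 dP]; exists d => // u u01.
by rewrite -!E//; exact: dP.
Qed.

Lemma is_deriv01_cst (c t : R) : is_deriv01 (fun=> c) t 0.
Proof.
apply/is_deriv01P => e e0; exists 1 => // u _ _ _.
by rewrite subrr mul0r subrr normr0 ltW.
Qed.

Lemma is_deriv01D s1 s2 t l1 l2 : is_deriv01 s1 t l1 -> is_deriv01 s2 t l2 ->
  is_deriv01 (fun u => s1 u + s2 u) t (l1 + l2).
Proof.
move=> H1 H2; rewrite /is_deriv01 /diffquot01.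
rewrite (_ : (fun u => _) = (fun u => (s1 u - s1 t) / (u - t) + (s2 u - s2 t) / (u - t))).
  exact: cvgD.
by apply/funext => u; rewrite -mulrDl; congr (_ / _); ring.
Qed.

Lemma is_deriv01Z (c : R) s t l : is_deriv01 s t l ->
  is_deriv01 (fun u => c * s u) t (c * l).
Proof.
move=> H; rewrite /is_deriv01 /diffquot01.
rewrite (_ : (fun u => _) = (fun u => c * ((s u - s t) / (u - t)))).
  by apply: cvgM => //; exact: cvg_cst.
by apply/funext => u; rewrite mulrA; congr (_ / _); ring.
Qed.

Lemma is_deriv01B s1 s2 t l1 l2 : is_deriv01 s1 t l1 -> is_deriv01 s2 t l2 ->
  is_deriv01 (fun u => s1 u - s2 u) t (l1 - l2).
Proof.
move=> H1 H2; have := is_deriv01D _ _ _ _ _ H1 (is_deriv01Z (-1) _ _ _ H2).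
rewrite mulN1r; congr (is_deriv01 _ _ _).
by apply/funext => u; rewrite mulN1r.
Qed.

(* [w] is the derivative at [p t] of the outer function, along the range of [p]. *)
Lemma is_deriv01_comp (G p : R -> R) t w p' : 0 <= t <= 1 ->
  (forall e, 0 < e -> exists2 d, 0 < d & forall u, 0 <= u <= 1 ->
    `|p u - p t| < d -> `|G (p u) - G (p t) - w * (p u - p t)| <= e * `|p u - p t|) ->
  is_deriv01 p t p' -> is_deriv01 (fun u => G (p u)) t (w * p').
Proof.
move=> t01 HG /is_deriv01P Hp; apply/is_deriv01P => e e0.
(* [K] bounds the difference quotients of [p] once they are within 1 of [p']. Then [e1] makes the
   error of [G] at most e / 2 after multiplication by [K], and [e2] does the same for the error of
   [p] multiplied by [|w|]. *)
pose K := `|p'| + 1; have K0 : 0 < K by rewrite ltr_wpDl.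
pose e1 := e / 2 / K; have e10 : 0 < e1 by rewrite !divr_gt0.
pose e2 := Num.min 1 (e / 2 / (`|w| + 1)).
have e20 : 0 < e2 by rewrite lt_min ltr01 !divr_gt0// ltr_wpDl.
have [d1 d10 dG] := HG e1 e10; have [d2 d20 dp] := Hp e2 e20.
exists (Num.min d2 (d1 / K)); first by rewrite lt_min d20 divr_gt0.
move=> u u01 ut; rewrite lt_min => /andP[ud2 ud1].
have ut0 : 0 < `|u - t| by rewrite normr_gt0 subr_eq0.
have := dp u u01 ut ud2; set q := _ / _ => qp.
have qK : `|q| <= K.
  rewrite -[q](subrK p'); apply: le_trans (ler_normD _ _) _.
  rewrite addrC lerD2l; apply: le_trans qp _; by rewrite ge_min lexx.
have pE : p u - p t = q * (u - t) by rewrite divfK// subr_eq0.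
have pd : `|p u - p t| < d1.
  rewrite pE normrM; apply: (@le_lt_trans _ _ (K * `|u - t|)).
    by rewrite ler_wpM2r.
  by rewrite mulrC -ltr_pdivlMr.
have := dG u u01 pd => Gp.
have -> : (G (p u) - G (p t)) / (u - t) - w * p' =
    (G (p u) - G (p t) - w * (p u - p t)) / (u - t) + w * (q - p').
  have h : u - t != 0 by rewrite subr_eq0.
  rewrite pE; move: (G _) (G _) => x y; field; exact: h.
apply: le_trans (ler_normD _ _) _; rewrite [e]splitr; apply: lerD.
  rewrite normrM normfV ler_pdivrMr//; apply: le_trans Gp _.
  rewrite pE normrM mulrA ler_wpM2r// /e1.
  by rewrite -mulrA ler_piMr ?divr_ge0 ?(ltW e0)// mulrC ler_pdivrMr// mul1r.
rewrite normrM; apply: (@le_trans _ _ (`|w| * (e / 2 / (`|w| + 1)))).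
  rewrite ler_wpM2l//; apply: le_trans qp _; by rewrite ge_min lexx orbT.
rewrite mulrCA ler_piMr ?divr_ge0 ?(ltW e0)// ler_pdivrMr ?ltr_wpDl// mul1r.
by rewrite lerDl.
Qed.

Lemma is_deriv01_continuous s (ds : R -> R) :
  (forall t, 0 <= t <= 1 -> is_deriv01 s t (ds t)) ->
  {within `[0, 1], continuous s}.
Proof.
move=> H; apply/continuous01P => t t01 e e0.
have /is_deriv01P/(_ 1 ltr01)[d d0 dP] := H t t01.
pose K := `|ds t| + 1; have K0 : 0 < K by rewrite ltr_wpDl.
exists (Num.min d (e / K)); first by rewrite lt_min d0 divr_gt0.
move=> u u01; rewrite lt_min => /andP[ud ue].
have [->|ut] := eqVneq u t; first by rewrite subrr normr0 ltW.
have := dP u u01 ut ud; set q := _ / _ => qp.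
have -> : s u - s t = q * (u - t) by rewrite divfK// subr_eq0.
rewrite normrM; apply: (@le_trans _ _ (K * `|u - t|)).
  rewrite ler_wpM2r// -[q](subrK (ds t)); apply: le_trans (ler_normD _ _) _.
  by rewrite addrC lerD2l.
by rewrite mulrC -ler_pdivlMr// ltW.
Qed.

Lemma is_deriv01_is_derive s t l : 0 < t < 1 -> is_deriv01 s t l ->
  is_derive t 1 s l.
Proof.
move=> /andP[t0 t1] /is_deriv01P H.
suff C : h^-1 *: ((s (h *: 1 + t) - s t) : R) @[h --> 0^'] --> l.
  by apply: DeriveDef; [apply/cvg_ex; exists l|exact/cvg_lim].
apply/cvgrPdist_le => e e0; have [d d0 dP] := H e e0.
rewrite nearE; apply/nbhs_ballP; exists (Num.min d (Num.min t (1 - t))).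
  by rewrite /= !lt_min d0 t0 subr_gt0.
move=> h/=; rewrite /ball/= sub0r normrN !lt_min => /and3P[hd ht h1] h0.
rewrite distrC /GRing.scale/= mulr1 mulrC.
have := dP (h + t); rewrite addrK; apply => //.
- move: ht h1; rewrite !ltr_norml => /andP[? ?] /andP[? ?]; apply/andP; split; lra.
- by rewrite -subr_eq0 addrK.
Qed.

(** The mean value theorem applies because relative and ordinary derivatives agree inside the
    interval, while at the ends relative derivability gives continuity. *)
Lemma is_deriv01_0_cst s : (forall t, 0 <= t <= 1 -> is_deriv01 s t 0) ->
  forall t, 0 <= t <= 1 -> s t = s 0.
Proof.
move=> H t /andP[t0 t1]; have [->//|tn0] := eqVneq t 0.
have tp : 0 < t by rewrite lt_neqAle eq_sym tn0.
have cs := is_deriv01_continuous s (fun=> 0) H.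
have [] := @MVT R s (fun=> 0) 0 t tp.
- move=> x; rewrite in_itv/= => /andP[x0 xt].
  have x1 : x < 1 by exact: lt_le_trans xt t1.
  by apply: is_deriv01_is_derive; [rewrite x0|apply: H; rewrite !ltW].
- apply: continuous_subspaceW cs => x/=; rewrite !in_itv/= => /andP[-> xt].
  exact: le_trans xt t1.
by move=> c _ /eqP; rewrite mul0r subr_eq0 => /eqP.
Qed.

Lemma continuous_comp_within (s c : R -> R) (A : set R) :
  {within A, continuous s} -> continuous c -> (forall v, A (c v)) ->
  continuous (fun v => s (c v)).
Proof.
move=> /subspace_continuousP cs cc cA v.
apply: (@cvg_comp _ _ _ c s _ (within A (nbhs (c v)))); last exact: cs.
by move=> P /cc; rewrite /= !near_simpl => H; near=> x; apply: (near H x).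
Unshelve. all: by end_near. Qed.
End UnitIntervalDerivative.

(** * The change of variable v = psi t - psi 0 *)

Section TimeChange.
Context {R : realType}.
Local Notation mu := (@lebesgue_measure R).
Implicit Types (p dp w : R -> R).

Definition time_change p dp : Prop :=
  [/\ p 0 = 0,
      forall s t, 0 <= s -> s < t -> t <= 1 -> p s < p t,
      forall t, 0 <= t <= 1 -> is_deriv01 p t (dp t),
      {within `[0, 1], continuous dp} &
      forall t, 0 <= t <= 1 -> dp t != 0].

Lemma time_change_psi (psi : R -> R) : C2_01 psi ->
  {in `[0, 1] &, {homo psi : s t / s < t}} ->
  {in `[0, 1], forall t, deriv01 psi t != 0} ->
  time_change (fun t => psi t - psi 0) (deriv01 psi).
Proof.
move=> [D1 D2 _] incr nz; split.
- by rewrite subrr.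
- move=> s t s0 st t1; rewrite ltrD2r; apply: incr => //; rewrite in_itv/=.
    by rewrite s0/= ltW// (lt_le_trans st).
  by rewrite t1 andbT ltW// (le_lt_trans s0).
- move=> t t01; rewrite -[deriv01 psi t]subr0.
  by apply: is_deriv01B; [apply/derivable01P/D1; rewrite in_itv|exact: is_deriv01_cst].
- apply: (is_deriv01_continuous _ (deriv01 (deriv01 psi))) => t t01.
  by apply/derivable01P/D2; rewrite in_itv.
- by move=> t t01; apply: nz; rewrite in_itv.
Qed.

Lemma time_change_le p dp s t : time_change p dp ->
  0 <= s -> s <= t -> t <= 1 -> p s <= p t.
Proof.
move=> [_ incr _ _ _] s0; rewrite le_eqVlt => /predU1P[->//|st] t1.
by rewrite ltW// incr.
Qed.

Lemma time_change_ge0 p dp t : time_change p dp -> 0 <= t <= 1 -> 0 <= p t.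
Proof.
move=> tc /andP[t0 t1]; have [p0 _ _ _ _] := tc.
by rewrite -p0; exact: (time_change_le p dp).
Qed.

Lemma time_change_continuous p dp : time_change p dp ->
  {within `[0, 1], continuous p}.
Proof. by move=> [_ _ derp _ _]; exact: (is_deriv01_continuous p dp). Qed.

Lemma time_change_deriv_ge0 p dp t : time_change p dp -> 0 <= t <= 1 -> 0 <= dp t.
Proof.
move=> [_ incr derp _ _] t01; rewrite leNgt; apply/negP => lt0.
have /is_deriv01P/(_ (- dp t / 2)) := derp t t01.
rewrite divr_gt0 ?oppr_gt0// => /(_ isT)[d d0 dP].
have [u [/andP[u0 u1] ut utd]] := near01 t d t01 d0; have /andP[t0 t1] := t01.
have q0 : 0 <= (p u - p t) / (u - t).
  move: ut; rewrite neq_lt => /orP[ut|tu].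
    by rewrite ltW// nmulr_rgt0 ?subr_lt0 ?incr// invr_lt0 subr_lt0.
  by rewrite ltW// divr_gt0 ?subr_gt0// incr.
have := dP u; rewrite u0 u1 => /(_ isT ut utd).
rewrite ger0_norm; lra.
Qed.

(** The inverse on [0, p 1] is precomposed with a clamp, so that it is continuous on R and never
    leaves [0,1]. Composition with [q] thus turns continuity relative to [0,1] into continuity on
    R. *)
Lemma time_change_inverse p dp : time_change p dp ->
  exists q : R -> R, [/\ continuous q, forall v, 0 <= q v <= 1 &
    forall t, 0 <= t <= 1 -> q (p t) = t].
Proof.
move=> tc; have [p0 incr _ _ _] := tc.
pose T := p 1; have T0 : 0 <= T by apply: (time_change_ge0 p dp) => //; rewrite ler01 lexx.
pose q0 v := xget 0 [set u | 0 <= u <= 1 /\ p u = v].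
have q01 v : 0 <= q0 v <= 1.
  by rewrite /q0; case: xgetP => [u _ []//|_]; rewrite lexx ler01.
have pq t : 0 <= t <= 1 -> q0 (p t) = t.
  move=> t01; rewrite /q0; case: xgetP => [u _ [u01 put]|/(_ t)[]//].
  have [/andP[t0 t1] /andP[u0 u1]] := (t01, u01).
  have [tu|ut|//] := ltgtP t u.
    by have := incr t u t0 tu u1; rewrite put ltxx.
  by have := incr u t u0 ut t1; rewrite put ltxx.
(* This formula clamps [v] to [0, T]; written with absolute values, it is visibly continuous. *)
pose c v := (`|v| + T - `|v - T|) / 2.
have cc : continuous c.
  move=> v; apply: cvgM; last exact: cvg_cst.
  apply: cvgB; first by apply: cvgD; [apply: cvg_norm; exact: cvg_id|exact: cvg_cst].
  by apply: cvg_norm; apply: cvgB; [exact: cvg_id|exact: cvg_cst].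
have cT v : 0 <= c v <= T.
  rewrite /c; have [v0|v0] := leP 0 v; have [vT|vT] := leP v T.
  - rewrite (ger0_norm v0) ler0_norm ?subr_le0//; apply/andP; split; lra.
  - rewrite (ger0_norm v0) gtr0_norm ?subr_gt0//; apply/andP; split; lra.
  - rewrite (ltr0_norm v0) ler0_norm ?subr_le0//; apply/andP; split; lra.
  - by move: (lt_trans vT v0); rewrite ltNge T0.
have cE v : 0 <= v <= T -> c v = v.
  move=> /andP[v0 vT]; rewrite /c ger0_norm// ler0_norm ?subr_le0//; lra.
exists (fun v => q0 (c v)); split => //.
- apply: (continuous_comp_within q0 c `[0, T]) => //.
  have := @segment_can_continuous R 0 1 p q0 ler01 (time_change_continuous p dp tc).
  rewrite p0 -/T (min_idPl T0) (max_idPr T0); apply.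
  by move=> t; rewrite in_itv/=; exact: pq.
- move=> t t01; rewrite cE ?pq//; rewrite (time_change_ge0 p dp)//=.
  by have /andP[t0 t1] := t01; exact: (time_change_le p dp).
Qed.

Lemma time_change_integrand_continuous p dp (G : R -> R) : time_change p dp ->
  continuous G -> {within `[0, 1], continuous (fun u => dp u * G (p u))}.
Proof.
move=> tc cG; have [_ _ _ /subspace_continuousP cdp _] := tc.
have /subspace_continuousP cp := time_change_continuous p dp tc.
apply/subspace_continuousP => u u01; apply: cvgM; first exact: cdp.
by apply: (@cvg_comp _ _ _ p G _ (nbhs (p u))); [exact: cp|exact: cG].
Qed.

Lemma time_change_integral p dp (G : R -> R) (t : R) : time_change p dp ->
  0 < t <= 1 -> continuous G ->
  (\int[mu]_(v in `]0%R, p t[) (G v)%:E =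
   \int[mu]_(u in `]0%R, t[) (dp u * G (p u))%:E)%E.
Proof.
move=> tc /andP[t0 t1] cG; have [p0 incr derp cdp _] := tc.
have sub : `[0, t]%classic `<=` `[0, 1]%classic by apply: subset_itvl; rewrite bnd_simp.
(* Substitution uses the two-sided derivative of [p], which is known to equal [dp] in the open
   interval; at the ends only one-sided limits enter. *)
have pE u : u \in `]0, t[ -> p^`()%classic u = dp u /\ derivable p u 1.
  rewrite in_itv/= => /andP[u0 ut]; have u1 := lt_le_trans ut t1.
  have D : is_derive u 1 p (dp u).
    by apply: is_deriv01_is_derive; [rewrite u0|apply: derp; rewrite !ltW].
  by split; [rewrite derive1E derive_val|exact: ex_derive].
have /(continuous_within_itvP _ t0)[cdp1 cdp2 cdp3] :=
  continuous_subspaceW sub cdp.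
have /(continuous_within_itvP _ t0)[cp1 cp2 cp3] :=
  continuous_subspaceW sub (time_change_continuous p dp tc).
have S := @integration_by_substitution_increasing R p G 0 t (ltW t0).
have mG : measurable_fun setT (EFin \o G).
  by apply/measurable_EFinP; exact: continuous_measurable_fun.
have mH : measurable_fun `]0, t[ (fun u => dp u * G (p u)).
  apply: (@measurable_funS _ _ R R `[0, 1]%classic) => //.
    by apply: subset_trans sub; exact: subset_itv_oo_cc.
  apply: subspace_continuous_measurable_fun => //.
  exact: time_change_integrand_continuous.
have E u : u \in `]0, t[%classic -> dp u * G (p u) = ((G \o p) * p^`()%classic) u.
  by rewrite inE/= => /pE[<- _]; rewrite mulrC.
rewrite -(@integral_itv_bndoo R 0 (p t) _ true false); last exact: measurable_funTS.
rewrite -{1}p0 S.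
- rewrite integral_itv_bndoo; last first.
    apply/measurable_EFinP; apply: eq_measurable_fun mH => u; exact: E.
  by apply: eq_integral => u; rewrite inE/= => u0t; rewrite E// inE.
- move=> x y; rewrite !in_itv/= => /andP[x0 _] /andP[_ yt] xy.
  by apply: incr => //; exact: le_trans t1.
- move=> x x0t; have := cdp1 x x0t; rewrite /continuous_at (pE x x0t).1.
  apply: cvg_trans; apply: near_eq_cvg; near=> u; rewrite (pE u _).1//.
  by near: u; exact: near_in_itvoo.
- apply/cvg_ex; exists (dp 0); apply: cvg_trans cdp2; apply: near_eq_cvg.
  near=> u; rewrite (pE u _).1// in_itv/=; apply/andP; split => //.
- apply/cvg_ex; exists (dp t); apply: cvg_trans cdp3; apply: near_eq_cvg.
  near=> u; rewrite (pE u _).1// in_itv/=; apply/andP; split => //.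
- by split => // x /pE[].
- exact: continuous_subspaceT.
Unshelve. all: by end_near. Qed.
End TimeChange.

(** * Fractional integrals under the change of variable *)

Section FractionalIntegral.
Context {R : realType}.
Local Notation mu := (@lebesgue_measure R).
Implicit Types (p dp w s : R -> R).

(** Keeping the base above 1 / (n + 1) makes the kernel continuous everywhere. For a <= 1 the
    exponent is nonpositive, so it increases with [n]; at each v < t it is eventually equal to the
    true kernel. *)
Definition truncated_kernel (a t : R) (n : nat) (v : R) : R :=
  Num.max (t - v) (harmonic n) `^ (a - 1).

Lemma max_harmonic_gt0 (x : R) n : 0 < Num.max x (harmonic n).
Proof. by rewrite lt_max harmonic_gt0 orbT. Qed.

Lemma truncated_kernel_continuous (a t : R) n :
  continuous (truncated_kernel a t n).
Proof.
move=> v; rewrite /truncated_kernel.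
apply: (@cvg_comp _ _ _ (fun v => Num.max (t - v) (harmonic n)) (@powR R ^~ (a - 1))
  _ (nbhs (Num.max (t - v) (harmonic n)))); last first.
  by apply: continuous_gt0_powR; exact: max_harmonic_gt0.
apply: (@continuous_max R R^o (fun v => t - v) (fun=> harmonic n) v).
  by apply: (@cvgB _ R^o); [exact: cvg_cst|exact: cvg_id].
exact: cvg_cst.
Qed.

Lemma truncated_kernel_ge0 (a t : R) n v : 0 <= truncated_kernel a t n v.
Proof. exact: powR_ge0. Qed.

Lemma truncated_kernel_nd (a t v : R) m n : a <= 1 -> (m <= n)%N ->
  truncated_kernel a t m v <= truncated_kernel a t n v.
Proof.
move=> a1 mn; rewrite /truncated_kernel.
set x := Num.max _ _; set y := Num.max _ _.
have y0 : 0 < y by exact: max_harmonic_gt0.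
have x0 : 0 < x by exact: max_harmonic_gt0.
have yx : y <= x.
  rewrite ge_max !le_max lexx/=; apply/orP; right.
  by rewrite lef_pV2 ?posrE ?ltr0n// ler_nat.
rewrite -[a - 1]opprB !powRN lef_pV2 ?posrE ?powR_gt0//.
by apply: ge0_ler_powR => //; rewrite ?subr_ge0 ?nnegrE ?(ltW x0) ?(ltW y0).
Qed.

Lemma cvg_truncated_kernel (a t v c : R) : v < t ->
  (truncated_kernel a t n v * c)%:E @[n --> \oo] --> (kp a (t - v) * c)%:E.
Proof.
move=> vt; apply: cvg_near_cst; have tv0 : 0 < t - v by rewrite subr_gt0.
have [k] := ltr_add_invr tv0; rewrite add0r => kx.
near=> n; rewrite kp_gt0// /truncated_kernel (_ : Num.max _ _ = t - v)//.
apply/max_idPl; apply: le_trans (ltW kx).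
rewrite lef_pV2 ?posrE ?ltr0n// ler_nat ltnS.
by near: n; exact: nbhs_infty_ge.
Unshelve. all: by end_near. Qed.

(* The kernel is singular at the right endpoint, so the change of variables is
   applied to the truncated kernels, which increase to it. *)
Lemma time_change_integral_kp p dp (a t : R) w : time_change p dp ->
  0 < t <= 1 -> a <= 1 -> continuous w -> (forall v, 0 <= w v) ->
  (\int[mu]_(v in `]0%R, p t[) (kp a (p t - v) * w v)%:E =
   \int[mu]_(u in `]0%R, t[) (dp u * (kp a (p t - p u) * w (p u)))%:E)%E.
Proof.
move=> tc t01 a1 cw w0; have [p0 incr derp cdp _] := tc.
have /andP[t0 t1] := t01.
pose K n v := truncated_kernel a (p t) n v * w v.
have cK n : continuous (K n).
  by move=> v; apply: cvgM; [exact: truncated_kernel_continuous|exact: cw].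
have K0 n v : 0 <= K n v by rewrite mulr_ge0// truncated_kernel_ge0.
have Knd v m n : (m <= n)%N -> K m v <= K n v.
  by move=> mn; rewrite ler_wpM2r// truncated_kernel_nd.
have inside u : `]0, t[%classic u -> 0 <= u <= 1 /\ p u < p t.
  rewrite /= in_itv/= => /andP[u0 ut].
  by rewrite (ltW u0) (ltW (lt_le_trans ut t1)) incr// ltW.
have mH n : measurable_fun `]0, t[%classic (fun u => (dp u * K n (p u))%:E).
  apply/measurable_EFinP; apply: (@measurable_funS _ _ R R `[0, 1]%classic) => //.
    by move=> u /inside[]; rewrite /= in_itv.
  apply: subspace_continuous_measurable_fun => //.
  exact: time_change_integrand_continuous.
have C1 := @cvg_monotone_convergence _ _ R mu `]0, p t[%classic (measurable_itv _)
  (fun n v => (K n v)%:E).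
have C2 := @cvg_monotone_convergence _ _ R mu `]0, t[%classic (measurable_itv _)
  (fun n u => (dp u * K n (p u))%:E).
have {C1} C1 : (\int[mu]_(v in `]0%R, p t[) (K n v)%:E)%E @[n --> \oo] -->
    (\int[mu]_(v in `]0%R, p t[) (kp a (p t - v) * w v)%:E)%E.
  rewrite (_ : (\int[mu]_(_ in _) _ = \int[mu]_(v in `]0%R, p t[) limn (fun n => (K n v)%:E))%E).
    apply: C1.
    - by move=> n; apply/measurable_EFinP; apply: measurable_funTS; exact: continuous_measurable_fun.
    - by move=> n v _; rewrite lee_fin.
    - by move=> v _ m n mn; rewrite lee_fin Knd.
  apply: eq_integral => v; rewrite inE/= in_itv/= => /andP[_ vt].
  by apply/esym/cvg_lim => //; exact: cvg_truncated_kernel.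
have {C2} C2 : (\int[mu]_(u in `]0%R, t[) (dp u * K n (p u))%:E)%E @[n --> \oo] -->
    (\int[mu]_(u in `]0%R, t[) (dp u * (kp a (p t - p u) * w (p u)))%:E)%E.
  rewrite (_ : (\int[mu]_(_ in _) _ =
      \int[mu]_(u in `]0%R, t[) limn (fun n => (dp u * K n (p u))%:E))%E).
    apply: C2 => //.
    - move=> n u /inside[u01 _]; rewrite lee_fin mulr_ge0//.
      exact: (time_change_deriv_ge0 p dp).
    - move=> u /inside[u01 _] m n mn; rewrite lee_fin ler_wpM2l ?Knd//.
      exact: (time_change_deriv_ge0 p dp).
  apply: eq_integral => u; rewrite inE => /inside[_ put].
  have E n : dp u * K n (p u) = truncated_kernel a (p t) n (p u) * (dp u * w (p u)).
    by rewrite /K mulrCA.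
  under eq_fun do rewrite E.
  rewrite mulrCA; apply/esym/cvg_lim => //; exact: cvg_truncated_kernel.
apply: (cvg_unique _ C1) => //.
rewrite (_ : (fun n => _) = (fun n => \int[mu]_(u in `]0%R, t[) (dp u * K n (p u))%:E)%E)//.
by apply/funext => n; exact: (time_change_integral p dp (K n)).
Qed.

(** Monotone convergence needs a sign, so [w] is split into positive and negative parts; both [dp]
    and the kernel are nonnegative and pass through the splitting. *)
Lemma time_change_Rintegral_kp p dp (a t : R) w : time_change p dp ->
  0 < t <= 1 -> a <= 1 -> continuous w ->
  \int[mu]_(v in `]0%R, p t[) (kp a (p t - v) * w v) =
  \int[mu]_(u in `]0%R, t[) (dp u * (kp a (p t - p u) * w (p u))).
Proof.
move=> tc t01 a1 cw; congr fine; rewrite integralE [RHS]integralE.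
have /andP[t0 t1] := t01.
have dp0 u : `]0, t[%classic u -> 0 <= dp u.
  rewrite /= in_itv => /andP[u0 ut]; apply: (time_change_deriv_ge0 p dp) => //.
  by rewrite (ltW u0) (ltW (lt_le_trans ut t1)).
have cmax (h : R -> R) : continuous h -> continuous (fun v => Num.max (h v) 0).
  by move=> ch v; apply: (@continuous_max R R^o h (fun=> 0) v); [exact: ch|exact: cvg_cst].
have maxM (x y : R) : 0 <= x -> Num.max (x * y) 0 = x * Num.max y 0.
  by move=> x0; rewrite maxr_pMr// mulr0.
have EFin_max0 (x : R) : maxe x%:E 0%E = (Num.max x 0)%:E by rewrite -EFin_max.
congr (_ - _)%E.
- transitivity (\int[mu]_(v in `]0%R, p t[) (kp a (p t - v) * Num.max (w v) 0)%:E)%E.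
    by apply: eq_integral => v _; rewrite funeposE EFin_max0 maxM ?kp_ge0.
  rewrite (time_change_integral_kp p dp)//; last 2 first.
  + exact: cmax.
  + by move=> v; rewrite le_max lexx orbT.
  apply: eq_integral => u; rewrite inE => /dp0 du.
  by rewrite funeposE EFin_max0 !maxM ?kp_ge0.
- transitivity (\int[mu]_(v in `]0%R, p t[) (kp a (p t - v) * Num.max (- w v) 0)%:E)%E.
    by apply: eq_integral => v _; rewrite funenegE -EFinN EFin_max0 -mulrN maxM ?kp_ge0.
  rewrite (time_change_integral_kp p dp a t (fun v => Num.max (- w v) 0))//; last 2 first.
  + by apply: cmax => v; apply: cvgN; exact: cw.
  + by move=> v; rewrite le_max lexx orbT.
  apply: eq_integral => u; rewrite inE => /dp0 du.
  by rewrite funenegE -EFinN EFin_max0 -2!mulrN !maxM ?kp_ge0.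
Qed.

(** Link between the psi-fractional integral and [RL]: [w] is a continuous function on R
    representing [s] in the new variable. It is used at order 2 - theta, which lies between 0 and 1,
    the range of the truncation argument. *)
Lemma frac_intE (psi : R -> R) (a t : R) w s :
  time_change (fun u => psi u - psi 0) (deriv01 psi) ->
  0 <= t <= 1 -> 0 < a < 1 -> continuous w ->
  (forall u, 0 <= u <= 1 -> s u = w (psi u - psi 0)) ->
  frac_int a psi s t = RL a w (psi t - psi 0).
Proof.
move=> tc t01 /andP[a0 a1] cw sE; have [p0 incr _ _ _] := tc.
have /andP[] := t01; rewrite le_eqVlt => /predU1P[<- _|t0 t1].
  rewrite subrr RL_le0// /frac_int set_itv1 Rintegral_set1 ?mulr0//.
rewrite /frac_int /RL; congr (_ * _).
set p := (fun u => psi u - psi 0) in tc incr *.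
have pt0 : 0 < p t by rewrite -[ltLHS]p0 incr.
rewrite [RHS](_ : _ = \int[mu]_(v in `]0%R, p t[) (kp a (p t - v) * w v)); last first.
  rewrite [RHS]Rintegral_mkcond; apply: eq_Rintegral => v _; rewrite patchE.
  case: ifPn; rewrite ?inE ?notin_setE/= in_itv/=.
    by move=> /andP[v0 _]; rewrite kp1_gt0 ?mul1r.
  move=> /negP; rewrite negb_and -!leNgt => /orP[v0|tv].
    by rewrite (kp_le0 1 v)// mul0r mulr0.
  by rewrite kp_le0 ?mul0r// subr_le0.
set dp := deriv01 psi in tc *.
rewrite (time_change_Rintegral_kp p dp) ?t0 ?(ltW a1)//.
have inside u : `]0, t[%classic u -> 0 <= u <= 1 /\ p u < p t.
  rewrite /= in_itv/= => /andP[u0 ut].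
  by rewrite (ltW u0) (ltW (lt_le_trans ut t1)) incr// ltW.
have E u : u \in `]0, t[%classic ->
    dp u * (kp a (p t - p u) * w (p u)) = dp u * (psi t - psi u) `^ (a - 1) * s u.
  rewrite inE => /inside[u01 put]; rewrite kp_gt0 ?subr_gt0// sE// mulrA.
  by rewrite /p opprB addrA subrK.
have sub : `]0, t[%classic `<=` `[0, 1]%classic by move=> u /inside[]; rewrite /= in_itv.
have mp : measurable_fun `]0, t[%classic p.
  apply: (@measurable_funS _ _ R R `[0, 1]%classic) => //.
  apply: subspace_continuous_measurable_fun => //.
  exact: time_change_continuous tc.
have mH : measurable_fun `]0, t[%classic
    (fun u => (dp u * (psi t - psi u) `^ (a - 1) * s u)%:E).
  apply/measurable_EFinP; apply: (eq_measurable_fun _ E).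
  apply: measurable_funM.
    apply: (@measurable_funS _ _ R R `[0, 1]%classic) => //.
    by apply: subspace_continuous_measurable_fun => //; have [] := tc.
  apply: measurable_funM; last exact: (measurableT_comp (continuous_measurable_fun cw)).
  apply: (measurableT_comp (measurable_kp a)).
  by apply: measurable_funB => //; exact: measurable_cst.
rewrite /Rintegral (@integral_itv_bndoo R 0 t _ true false)//; congr fine.
by apply: eq_integral => u /E ->.
Qed.
End FractionalIntegral.

(** * Equivalence of the Caputo equation and its integral form *)

Section CaputoEquation.
Context {R : realType}.
Implicit Types (p dp q w x psi : R -> R).

Lemma time_change_surj p dp v : time_change p dp -> 0 <= v <= p 1 ->
  exists2 t, 0 <= t <= 1 & p t = v.
Proof.
move=> tc v01; have [p0 _ _ _ _] := tc.
have T0 : 0 <= p 1 by apply: (time_change_ge0 p dp) => //; rewrite ler01 lexx.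
have [|t] := @IVT R p 0 1 v ler01 (time_change_continuous p dp tc).
  by rewrite p0 (min_idPl T0) (max_idPr T0).
by rewrite in_itv/=; exists t.
Qed.

Lemma is_deriv01_RL1 p dp w t : time_change p dp -> 0 <= t <= 1 ->
  continuous w -> is_deriv01 (fun u => RL 1 w (p u)) t (w (p t) * dp t).
Proof.
move=> tc t01 cw; have [_ _ derp _ _] := tc.
have pt0 := time_change_ge0 p dp t tc t01.
apply: is_deriv01_comp => //; last exact: derp.
move=> e e0.
have /cvgrPdist_le/(_ e e0) := cw (p t).
rewrite nearE => /nbhs_ballP[d/= d0 dP]; exists d => // u u01 upd.
have we v : `|v - p t| < d -> `|w v - w (p t)| <= e.
  by move=> vd; rewrite distrC; apply: dP; rewrite /ball/= distrC.
have pu0 := time_change_ge0 p dp u tc u01.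
have [tu|ut] := leP (p t) (p u).
  rewrite [leRHS](_ : _ = e * (p u - p t)); last by rewrite ger0_norm ?subr_ge0.
  apply: RL1_increment => //; first exact: ltW.
  move=> v /andP[tv vu]; apply: we; apply: le_lt_trans upd.
  by rewrite !ger0_norm ?subr_ge0// lerD2r.
have -> : RL 1 w (p u) - RL 1 w (p t) - w (p t) * (p u - p t) =
    - (RL 1 w (p t) - RL 1 w (p u) - w (p t) * (p t - p u)).
  by move: (RL 1 w _) (RL 1 w _) => y z; ring.
rewrite normrN.
rewrite [leRHS](_ : _ = e * (p t - p u)); last first.
  by rewrite ltr0_norm ?subr_lt0// opprB.
apply: RL1_increment => //; [exact: ltW|exact: ltW|].
move=> v /andP[uv vt]; apply: we; apply: le_lt_trans upd.
by rewrite !ler0_norm ?subr_le0 ?(ltW ut)// lerN2 lerD2r.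
Qed.

(** A function of order 1 + b > 1 in [p] has slope 0 at 0. It serves twice: for [RL a w] with b = a
    - 1, and for the fractional integral of the Taylor remainder with b = 2 - a. *)
Lemma is_deriv01_power p dp (G : R -> R) (C b d0 : R) : time_change p dp ->
  0 < b -> 0 <= C -> 0 < d0 ->
  (forall u, 0 <= u <= 1 -> p u < d0 -> `|G (p u)| <= C * p u `^ b * p u) ->
  is_deriv01 (fun u => G (p u)) 0 0.
Proof.
move=> tc b0 C0 d00 GC; have [p0 _ derp _ _] := tc.
have z01 : 0 <= (0 : R) <= 1 by rewrite lexx ler01.
rewrite -[X in is_deriv01 _ _ X](mul0r (dp 0)).
apply: is_deriv01_comp => //; last exact: derp.
move=> e e0; pose k := e / (C + 1).
have C10 : 0 < C + 1 by rewrite ltr_wpDl.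
have k0 : 0 < k by rewrite divr_gt0.
(* Below k^(1/b) the power p^b is at most [k], and C k <= e by the choice of [k]. *)
exists (Num.min d0 (k `^ b^-1)); first by rewrite lt_min d00 powR_gt0.
move=> u u01; rewrite p0 subr0 mul0r subr0 lt_min.
have pu0 := time_change_ge0 p dp u tc u01.
rewrite ger0_norm// => /andP[ud uk].
have -> : G 0 = 0.
  have := GC 0 z01; rewrite p0 mulr0 => /(_ d00).
  by rewrite normr_le0 => /eqP.
rewrite subr0; apply: le_trans (GC u u01 ud) _; rewrite ler_wpM2r//.
apply: (@le_trans _ _ (C * k)).
  rewrite ler_wpM2l//; apply: (@le_trans _ _ ((k `^ b^-1) `^ b)).
    by apply: ge0_ler_powR; rewrite ?nnegrE ?powR_ge0 ?(ltW b0) ?(ltW uk).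
  by rewrite -powRrM mulVf ?gt_eqF// powRr1// ltW.
by rewrite mulrCA ler_piMr ?(ltW e0)// ler_pdivrMr// mul1r lerDl.
Qed.

Lemma psi_derivE psi s t l :
  time_change (fun u => psi u - psi 0) (deriv01 psi) -> 0 <= t <= 1 ->
  is_deriv01 s t (l * deriv01 psi t) ->
  derivable01 s t /\ psi_deriv psi s t = l.
Proof.
move=> [_ _ _ _ nz] t01 /(is_deriv01_deriv _ _ _ t01)[D E]; split => //.
by rewrite /psi_deriv E mulrC mulfK// nz.
Qed.

Lemma is_deriv01_psi_deriv psi s t :
  time_change (fun u => psi u - psi 0) (deriv01 psi) -> 0 <= t <= 1 ->
  derivable01 s t -> is_deriv01 s t (psi_deriv psi s t * deriv01 psi t).
Proof.
move=> [_ _ _ _ nz] t01 /derivable01P; congr is_deriv01.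
by rewrite /psi_deriv mulrC mulVKf// nz.
Qed.

Lemma taylor_remE psi x t : x 0 = 0 ->
  taylor_rem psi x t = x t - psi_deriv psi x 0 * (psi t - psi 0).
Proof.
move=> x0; rewrite /taylor_rem !big_ord_recl big_ord0/= x0 expr1.
by rewrite !(mul0r, add0r, addr0) divr1.
Qed.

Section TimeChanged.
Variables (psi : R -> R) (a : R).
Let p t := psi t - psi 0.
Let dp := deriv01 psi.
Hypothesis tc : time_change p dp.
Hypothesis a12 : 1 < a < 2.

Let a0 : 0 < a. Proof. by have /andP[a1 _] := a12; exact: lt_trans a1. Qed.
Let b0 : 0 < a - 1. Proof. by rewrite subr_gt0; have /andP[] := a12. Qed.
Let b01 : 0 < 2 - a < 1.
Proof. by have /andP[a1 a2] := a12; apply/andP; split; lra. Qed.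
Let p0 : p 0 = 0. Proof. by rewrite /p subrr. Qed.
Let z01 : 0 <= (0 : R) <= 1. Proof. by rewrite lexx ler01. Qed.

(** Since a > 1, [RL a w] has slope 0 at 0, so [c] is exactly the first Taylor coefficient and the
    remainder is [RL a w]. Its integral of order 2 - a is [RL 1 (RL 1 w)], which is differentiated
    twice. *)
Lemma caputo_RL (c : R) w x : continuous w ->
  (forall t, 0 <= t <= 1 -> x t = RL a w (p t) + c * p t) ->
  caputo_derivable a psi x /\
  (forall t, 0 <= t <= 1 -> caputo_deriv a psi x t = w (p t)).
Proof.
move=> cw xE; have /andP[a1 a2] := a12; have [_ _ derp _ nz] := tc.
have cRa : continuous (RL a w) by exact: continuous_RL.
have x0 : x 0 = 0 by rewrite xE// p0 RL_le0// mulr0 addr0.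
have [dx px] : derivable01 x 0 /\ psi_deriv psi x 0 = c.
  apply: psi_derivE => //; apply: (@eq_is_deriv01 _ (fun t => RL a w (p t) + c * p t)) => //.
    by move=> u u01; rewrite xE.
  rewrite -[c * _]add0r; apply: is_deriv01D; last exact/is_deriv01Z/derp.
  have [M [M0 wM]] := continuous_bounded_itv w 0 (p 1) cw.
  apply: (@is_deriv01_power p dp (RL a w) (M / Gamma (a + 1)) (a - 1) 1) => //.
    by rewrite divr_ge0// ltW// Gamma_gt0// addr_gt0.
  move=> u u01 _; have pu0 := time_change_ge0 p dp u tc u01.
  rewrite -mulrA -[X in _ * (_ * X)]powRr1//.
  rewrite -powRD; last by rewrite subrK (gt_eqF a0).
  rewrite subrK mulrAC; apply: RL_bound => //; first exact: continuous_measurable_fun.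
  move=> v /andP[v0 vu]; apply: wM; rewrite (ltW v0)/=; apply: le_trans (ltW vu) _.
  by have /andP[u0 u1] := u01; apply: (time_change_le p dp).
have remE t : 0 <= t <= 1 -> taylor_rem psi x t = RL a w (p t).
  by move=> t01; rewrite taylor_remE// px xE// addrK.
pose h := frac_int (2 - a) psi (taylor_rem psi x).
have hE t : 0 <= t <= 1 -> h t = RL 1 (RL 1 w) (p t).
  move=> t01; transitivity (RL (2 - a) (RL a w) (p t)); first exact: frac_intE.
  have [_ ->] := RL_semigroup_continuous (2 - a) a (p t) w (andP b01).1 a0 cw.
  have [_ ->] := RL_semigroup_continuous 1 1 (p t) w ltr01 ltr01 cw.
  by rewrite subrK.
have h1 t : 0 <= t <= 1 -> derivable01 h t /\ psi_deriv psi h t = RL 1 w (p t).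
  move=> t01; apply: psi_derivE => //.
  apply: (@eq_is_deriv01 _ (fun u => RL 1 (RL 1 w) (p u))) => //.
    by move=> u u01; rewrite hE.
  exact: (is_deriv01_RL1 p dp (RL 1 w) t tc t01 (continuous_RL1 w cw)).
have h2 t : 0 <= t <= 1 ->
    derivable01 (psi_deriv psi h) t /\ psi_deriv psi (psi_deriv psi h) t = w (p t).
  move=> t01; apply: psi_derivE => //.
  apply: (@eq_is_deriv01 _ (fun u => RL 1 w (p u))) => //.
    by move=> u u01; rewrite (h1 u u01).2.
  exact: is_deriv01_RL1.
split; last by move=> t /h2[].
split => // -[|[|//]] _ t; rewrite in_itv => t01; first by have [] := h1 t t01.
by have [] := h2 t t01.
Qed.

Lemma caputo_RL_inv w x : continuous w -> {within `[0, 1], continuous x} ->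
  x 0 = 0 -> caputo_derivable a psi x ->
  (forall t, 0 <= t <= 1 -> caputo_deriv a psi x t = w (p t)) ->
  exists c, forall t, 0 <= t <= 1 -> x t = RL a w (p t) + c * p t.
Proof.
move=> cw cx x0 [dx RLd] cE; have /andP[a1 a2] := a12; have [_ incr derp _ nz] := tc.
have [q [cq q01 qp]] := time_change_inverse p dp tc.
have cRa : continuous (RL a w) by exact: continuous_RL.
pose c := psi_deriv psi x 0; exists c.
(* This is the Taylor remainder, because x 0 = 0; its slope at 0 vanishes by the choice of [c]. *)
pose r t := x t - c * p t.
have derr0 : is_deriv01 r 0 0.
  rewrite -[X in is_deriv01 _ _ X](subrr (c * dp 0)); apply: is_deriv01B; last exact/is_deriv01Z/derp.
  exact: is_deriv01_psi_deriv.
have r0 : r 0 = 0 by rewrite /r x0 p0 mulr0 subrr.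
have cr : {within `[0, 1], continuous r}.
  have /subspace_continuousP cp := time_change_continuous p dp tc.
  move/subspace_continuousP : cx => cx.
  apply/subspace_continuousP => t t01; apply: cvgB; first exact: cx.
  by apply: cvgM; [exact: cvg_cst|exact: cp].
pose rq v := r (q v).
have crq : continuous rq.
  by apply: (@continuous_comp_within _ r q `[0, 1]%classic) => // v; rewrite /= in_itv/=.
pose h := frac_int (2 - a) psi (taylor_rem psi x).
have hE t : 0 <= t <= 1 -> h t = RL (2 - a) rq (p t).
  move=> t01; apply: frac_intE => // u u01.
  by rewrite taylor_remE// /rq qp.
have h0 : h 0 = 0 by rewrite hE// p0 RL_le0.
pose h1 := psi_deriv psi h.
have dh t : 0 <= t <= 1 -> is_deriv01 h t (h1 t * dp t).
  move=> t01; apply: (is_deriv01_psi_deriv psi h t tc t01).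
  by apply: (RLd 0%N); rewrite ?in_itv.
have dh1 t : 0 <= t <= 1 -> is_deriv01 h1 t (w (p t) * dp t).
  move=> t01; rewrite -cE//; apply: (is_deriv01_psi_deriv psi h1 t tc t01).
  by apply: (RLd 1%N); rewrite ?in_itv.
have h1E t : 0 <= t <= 1 -> h1 t = h1 0 + RL 1 w (p t).
  move=> t01.
  have : h1 t - RL 1 w (p t) = h1 0 - RL 1 w (p 0).
    apply: (is_deriv01_0_cst (fun t => h1 t - RL 1 w (p t))) => // u u01.
    rewrite -(subrr (w (p u) * dp u)); apply: is_deriv01B; first exact: dh1.
    exact: is_deriv01_RL1.
  by rewrite p0 (RL_le0 _ 0)// subr0 => <-; rewrite subrK.
(* The slope of [h] at 0 is [h1 0 * dp 0], and it is also 0 because [h] is of order 3 - a in [p];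
   then [dp 0] is cancelled. *)
have h1_0 : h1 0 = 0.
  have dp0 : 0 < dp 0 by rewrite lt_neqAle eq_sym nz// (time_change_deriv_ge0 p dp).
  have [d1 d10 rd] := (is_deriv01P _ _ _).1 derr0 1 ltr01.
  have [d2 d20 pd] := (is_deriv01P _ _ _).1 (derp 0 z01) (dp 0 / 2) (divr_gt0 dp0 (ltr0Sn R 1)).
  pose d := Num.min 1 (Num.min d1 d2 / 2).
  have d0 : 0 < d by rewrite lt_min ltr01 divr_gt0// lt_min d10.
  have dle1 : d <= 1 by rewrite ge_min lexx.
  have dd : d < d1 /\ d < d2.
    have m0 : 0 < Num.min d1 d2 by rewrite lt_min d10.
    have m1 : Num.min d1 d2 <= d1 by rewrite ge_min lexx.
    have m2 : Num.min d1 d2 <= d2 by rewrite ge_min lexx orbT.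
    have dm : d <= Num.min d1 d2 / 2 by rewrite ge_min lexx orbT.
    by split; lra.
  (* Up to [d], [|r u|] is at most [u] (slope 0, tolerance 1) and [p u] is at least [u * dp 0 / 2]
     (tolerance [dp 0 / 2]); the ratio of the two bounds is [C]. *)
  pose C := 2 / dp 0; have C0 : 0 < C by rewrite divr_gt0.
  have rC u : 0 <= u -> u <= d -> `|r u| <= C * p u.
    rewrite le_eqVlt => /predU1P[<- _|u0 ud]; first by rewrite r0 p0 normr0 mulr0.
    have u01 : 0 <= u <= 1 by rewrite (ltW u0)/= (le_trans ud).
    have un0 : u != 0 by rewrite gt_eqF.
    have [ud1 ud2] : `|u - 0| < d1 /\ `|u - 0| < d2.
      by rewrite subr0 gtr0_norm//; case: dd => *; split; exact: le_lt_trans ud _.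
    have := rd u u01 un0 ud1; rewrite r0 !subr0 normrM normfV (gtr0_norm u0).
    rewrite ler_pdivrMr// mul1r => ru; apply: le_trans ru _.
    have := pd u u01 un0 ud2; rewrite p0 !subr0 ler_distl => /andP[+ _].
    rewrite ler_pdivlMr// => pu.
    rewrite /C mulrAC ler_pdivlMr//; move: pu; set k := dp 0; lra.
  apply: (mulIf (nz 0 z01)); rewrite mul0r.
  apply: (is_deriv01_unique h 0) => //; first exact: dh.
  apply: (@eq_is_deriv01 _ (fun u => RL (2 - a) rq (p u))) => //.
    by move=> u u01; rewrite hE.
  have g0 : 0 < Gamma (2 - a + 1) by rewrite Gamma_gt0// addr_gt0//; case/andP: b01.
  apply: (@is_deriv01_power p dp _ (C / Gamma (2 - a + 1)) (2 - a) (p d)) => //.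
  - by case/andP: b01.
  - by rewrite divr_ge0 ?ltW.
  - by rewrite -p0 incr.
  move=> u u01 pud; have pu0 := time_change_ge0 p dp u tc u01.
  (* [RL_bound] is used with the bound [C * p u], valid on []0, p u[] since the remainder is at most
     [C * v] there; this supplies the extra factor [p u]. *)
  rewrite [leRHS](_ : _ = C * p u * p u `^ (2 - a) / Gamma (2 - a + 1)); last first.
    by move: (Gamma _) (p u `^ _) => y z; ring.
  apply: RL_bound => //; [by case/andP: b01|exact: continuous_measurable_fun|].
  move=> v /andP[v0 vu]; apply: (@le_trans _ _ (C * v)); last first.
    by rewrite ler_wpM2l ?ltW.
  have v01 : 0 <= v <= p 1.
    rewrite (ltW v0)/= (le_trans (ltW (lt_trans vu pud)))//.
    exact: (time_change_le p dp d 1 tc (ltW d0)).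
  have [s s01 sv] := time_change_surj p dp v tc v01.
  rewrite -sv /rq qp//; have /andP[s0 s1] := s01; apply: rC => //.
  rewrite leNgt; apply/negP => ds; have := incr d s (ltW d0) ds s1.
  by rewrite sv ltNge (ltW (lt_trans vu pud)).
have hw t : 0 <= t <= 1 -> h t = RL 2 w (p t).
  move=> t01.
  have E v : RL 1 (RL 1 w) v = RL 2 w v.
    by have [_ ->] := RL_semigroup_continuous 1 1 v w ltr01 ltr01 cw.
  have : h t - RL 1 (RL 1 w) (p t) = h 0 - RL 1 (RL 1 w) (p 0).
    apply: (is_deriv01_0_cst (fun t => h t - RL 1 (RL 1 w) (p t))) => // u u01.
    rewrite -(subrr (RL 1 w (p u) * dp u)); apply: is_deriv01B.
      by have := dh u u01; rewrite h1E// h1_0 add0r.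
    exact: (is_deriv01_RL1 p dp (RL 1 w) u tc u01 (continuous_RL1 w cw)).
  by rewrite h0 p0 (RL_le0 _ 0)// subr0 E => /eqP; rewrite subr_eq0 => /eqP.
(* The orders a - 1 and 2 - a add up to 1. The restriction to v <= p 1 is harmless for the
   integrals, which see []0, v[] only, where the identity for [h] is available. *)
have rqw v : 0 <= v <= p 1 -> RL 1 rq v = RL 1 (RL a w) v.
  move=> v01.
  have b20 : 0 < 2 - a by case/andP: b01.
  have [_ E1] := RL_semigroup_continuous (a - 1) (2 - a) v rq b0 b20 crq.
  have [_ E2] := RL_semigroup_continuous (a - 1) (2 - a) v (RL a w) b0 b20 cRa.
  have s1 : a - 1 + (2 - a) = 1 by ring.
  rewrite s1 in E1 E2; rewrite -E1 -E2; apply: eq_RL => u /andP[u0 uv].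
  have [t t01 <-] : exists2 t, 0 <= t <= 1 & p t = u.
    apply: (time_change_surj p dp) => //; rewrite (ltW u0)/=.
    by case/andP: v01 => _; exact/le_trans/ltW.
  rewrite -(hE t t01) (hw t t01).
  have [_ ->] := RL_semigroup_continuous (2 - a) a (p t) w b20 a0 cw.
  by rewrite subrK.
move=> t t01; suff : rq (p t) = RL a w (p t).
  by rewrite /rq qp// /r => <-; rewrite subrK.
apply: (mulIf (nz t t01)).
apply: (is_deriv01_unique (fun u => RL 1 rq (p u)) t) => //; first exact: is_deriv01_RL1.
apply: (@eq_is_deriv01 _ (fun u => RL 1 (RL a w) (p u))) => //; last exact: is_deriv01_RL1.
move=> u u01; rewrite rqw// (time_change_ge0 p dp)//=.
by have /andP[u0 u1] := u01; exact: (time_change_le p dp).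
Qed.
End TimeChanged.
End CaputoEquation.

(** * A contraction principle for pairs of continuous functions *)

Section CoupledFixpoint.
Context {R : realType}.

Lemma geometric_small (C k e : R) : 0 <= k < 1 -> 0 < e ->
  exists n, C * k ^+ n <= e.
Proof.
move=> /andP[k0 k1] e0.
have H : (C * k ^+ n) @[n --> \oo] --> C * 0.
  by apply: cvgM; [exact: cvg_cst|apply: cvg_expr; rewrite ger0_norm].
move/cvgrPdist_le : H => /(_ e e0)[n _ /(_ n (leqnn n))] /=.
by rewrite mulr0 sub0r normrN => nP; exists n; exact: le_trans (ler_norm _) nP.
Qed.

Lemma geometric_le0 (x C k : R) : 0 <= k < 1 ->
  (forall n, x <= C * k ^+ n) -> x <= 0.
Proof.
move=> k01 xC; apply/ler_addgt0Pr => e e0; rewrite add0r.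
by have [n] := geometric_small C k e k01 e0; exact: le_trans.
Qed.

(** With C = D / (1 - k), the step D k^n equals C k^n - C k^(n+1), so the intervals of radius C k^n
    around [u n] are nested; the supremum of their left ends lies in all of them. *)
Lemma geometric_cauchy_limit (u : nat -> R) (D k : R) : 0 <= k < 1 ->
  (forall n, `|u n.+1 - u n| <= D * k ^+ n) ->
  exists l, forall n, `|u n - l| <= D / (1 - k) * k ^+ n.
Proof.
move=> /andP[k0 k1] uD; have k10 : 0 < 1 - k by rewrite subr_gt0.
pose C := D / (1 - k).
have CD n : D * k ^+ n = C * k ^+ n - C * k ^+ n.+1.
  by rewrite exprS /C; field; rewrite gt_eqF.
pose a n := u n - C * k ^+ n; pose b n := u n + C * k ^+ n.
have D0 : 0 <= D by have := uD 0%N; rewrite expr0 mulr1; exact/le_trans.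
have ab n : a n <= b n.
  have : 0 <= C * k ^+ n by rewrite mulr_ge0 ?exprn_ge0 ?divr_ge0 ?(ltW k10).
  rewrite /a /b; lra.
have aS : {homo a : m n / (m <= n)%N >-> m <= n}.
  apply/nondecreasing_seqP => n; have := uD n.
  rewrite CD ler_norml /a => /andP[+ _]; lra.
have bS : {homo b : m n / (m <= n)%N >-> n <= m}.
  apply/nonincreasing_seqP => n; have := uD n.
  rewrite CD ler_norml /b => /andP[_]; lra.
have abm m n : a m <= b n.
  apply: (le_trans (aS _ _ (leq_maxl m n))); apply: (le_trans (ab _)).
  by apply: bS; exact: leq_maxr.
exists (sup (range a)) => n; rewrite ler_distlC.
have aub : ubound (range a) (b n) by move=> _ [m _ <-].
apply/andP; split.
- apply: (@ub_le_sup _ (range a)); last by exists n.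
  by exists (b n).
- by apply: ge_sup => //; exists (a 0%N); exists 0%N.
Qed.

Lemma geometric_limit_continuous (u : nat -> R -> R) (l : R -> R) (C k : R) :
  0 <= k < 1 -> (forall n, continuous (u n)) ->
  (forall n v, `|u n v - l v| <= C * k ^+ n) -> continuous l.
Proof.
move=> k01 cu ul v; apply/cvgrPdist_le => e e0.
have e30 : 0 < e / 3 by rewrite divr_gt0.
have [n nP] := geometric_small C k (e / 3) k01 e30.
have /cvgrPdist_le/(_ _ e30) := cu n v.
apply: filterS => z uz.
have -> : l v - l z = (l v - u n v) + (u n v - u n z) + (u n z - l z) by ring.
have -> : e = e / 3 + e / 3 + e / 3 by lra.
apply: le_trans (ler_normD _ _) _; apply: lerD; last exact: le_trans (ul n z) nP.
apply: le_trans (ler_normD _ _) _; apply: lerD => //.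
by rewrite distrC; exact: le_trans (ul n v) nP.
Qed.

Variables (F1 F2 : (R -> R) -> (R -> R) -> R -> R) (k : R).
Hypothesis k01 : 0 <= k < 1.
Hypothesis F_contraction : forall X Y X' Y' M,
  continuous X -> continuous Y -> continuous X' -> continuous Y' ->
  (forall v, `|X v - X' v| + `|Y v - Y' v| <= M) ->
  forall v, `|F1 X Y v - F1 X' Y' v| + `|F2 X Y v - F2 X' Y' v| <= k * M.

(** Iteration shrinks the distance to M k^n for every n. Functions on R may be unbounded, so a
    finite initial distance [M] has to be supplied. *)
Lemma coupled_fixpoint_unique X Y X' Y' M :
  continuous X -> continuous Y -> continuous X' -> continuous Y' ->
  F1 X Y = X -> F2 X Y = Y -> F1 X' Y' = X' -> F2 X' Y' = Y' ->
  (forall v, `|X v - X' v| + `|Y v - Y' v| <= M) -> X = X' /\ Y = Y'.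
Proof.
move=> cX cY cX' cY' FX FY FX' FY' XM.
have H n v : `|X v - X' v| + `|Y v - Y' v| <= M * k ^+ n.
  elim: n v => [v|n IH v]; first by rewrite expr0 mulr1.
  rewrite exprS mulrCA.
  by have := F_contraction X Y X' Y' _ cX cY cX' cY' IH v; rewrite FX FY FX' FY'.
have H0 v : `|X v - X' v| + `|Y v - Y' v| <= 0.
  by apply: (geometric_le0 _ M k k01) => n; exact: H.
by split; apply/funext => v; apply/eqP; rewrite -subr_eq0 -normr_le0;
  apply: le_trans (H0 v); rewrite ?lerDl ?lerDr.
Qed.

Hypothesis F_continuous : forall X Y, continuous X -> continuous Y ->
  continuous (F1 X Y) /\ continuous (F2 X Y).

Lemma coupled_fixpoint (D : R) :
  (forall v, `|F1 (fun=> 0) (fun=> 0) v| + `|F2 (fun=> 0) (fun=> 0) v| <= D) ->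
  exists X Y, [/\ continuous X, continuous Y, F1 X Y = X & F2 X Y = Y].
Proof.
move=> FD; have /andP[k0 k1] := k01.
pose Z n := iter n (fun Z => (F1 Z.1 Z.2, F2 Z.1 Z.2)) ((fun=> 0), (fun=> 0)).
have cZ n : continuous (Z n).1 /\ continuous (Z n).2.
  elim: n => [|n [c1 c2]]; last exact: F_continuous.
  by split => v; exact: cvg_cst.
have ZD n v : `|(Z n.+1).1 v - (Z n).1 v| + `|(Z n.+1).2 v - (Z n).2 v| <= D * k ^+ n.
  elim: n v => [v|n IH v]; first by rewrite expr0 mulr1 /= !subr0.
  rewrite exprS mulrCA; have [c1 c2] := cZ n; have [c3 c4] := cZ n.+1.
  exact: F_contraction.
have /choice[X XP] v : exists l, forall n, `|(Z n).1 v - l| <= D / (1 - k) * k ^+ n.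
  by apply: geometric_cauchy_limit => // n; apply: le_trans (ZD n v); rewrite lerDl.
have /choice[Y YP] v : exists l, forall n, `|(Z n).2 v - l| <= D / (1 - k) * k ^+ n.
  by apply: geometric_cauchy_limit => // n; apply: le_trans (ZD n v); rewrite lerDr.
set C := D / (1 - k) in XP YP.
have cX : continuous X by apply: (geometric_limit_continuous (fun n => (Z n).1) X C k k01) => // n; case: (cZ n).
have cY : continuous Y by apply: (geometric_limit_continuous (fun n => (Z n).2) Y C k k01) => // n; case: (cZ n).
(* Through the iterate n + 1: contraction of the distance 2 C k^n from iterate n to the limit gives
   2 k C k^n, and the distances of the two components of iterate n + 1 to the limit give another 2 k
   C k^n. *)
have FXY n v : `|F1 X Y v - X v| + `|F2 X Y v - Y v| <= 4 * k * C * k ^+ n.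
  have [c1 c2] := cZ n.
  have FZ : `|F1 (Z n).1 (Z n).2 v - F1 X Y v| + `|F2 (Z n).1 (Z n).2 v - F2 X Y v|
      <= k * (C * k ^+ n + C * k ^+ n).
    by apply: F_contraction => // u; apply: lerD.
  have := XP v n.+1; have := YP v n.+1; rewrite exprS /= => Y1 X1.
  have tri (x y z : R) : `|y - z| <= `|x - y| + `|x - z|.
    by rewrite -[y - z](subrKA x) [`|x - y|]distrC; exact: ler_normD.
  have := tri (F1 (Z n).1 (Z n).2 v) (F1 X Y v) (X v).
  have := tri (F2 (Z n).1 (Z n).2 v) (F2 X Y v) (Y v).
  lra.
have F0 v : `|F1 X Y v - X v| + `|F2 X Y v - Y v| <= 0.
  by apply: (geometric_le0 _ (4 * k * C) k k01) => n; exact: FXY.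
exists X, Y; split => //; apply/funext => v; apply/eqP;
  rewrite -subr_eq0 -normr_le0; apply: le_trans (F0 v); rewrite ?lerDl ?lerDr//.
Qed.
End CoupledFixpoint.

(** * The boundary value problem and the system as a fixed point equation *)

Section ThreePointProblem.
Context {R : realType}.
Implicit Types (q w psi : R -> R).

(* [e] and [T] are the values at [eta] and [1] of the new variable
   [psi t - psi 0]; the linear term adjusts the boundary condition. *)
Definition bvp_op (a lam e T : R) w (v : R) : R :=
  RL a w v + (RL a w T - lam * RL a w e) / (lam * e - T) * v.

Lemma bvp_op_continuous (a lam e T : R) w : 1 < a -> continuous w ->
  continuous (bvp_op a lam e T w).
Proof.
move=> a1 cw v; apply: cvgD; first exact: continuous_RL.
by apply: cvgM; [exact: cvg_cst|exact: cvg_id].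
Qed.

Lemma RL_lipschitz (a T v M : R) w w' : 0 < a -> continuous w -> continuous w' ->
  (forall v, `|w v - w' v| <= M) -> 0 <= v <= T ->
  `|RL a w v - RL a w' v| <= M / Gamma (a + 1) * T `^ a.
Proof.
move=> a0 cw cw' wM /andP[v0 vT].
have M0 : 0 <= M by exact: le_trans (wM 0).
have g0 : 0 < Gamma (a + 1) by rewrite Gamma_gt0// addr_gt0.
rewrite -RLB; [|exact: RL_integrable_continuous..].
have cB : continuous (fun v => w v - w' v).
  by move=> u; apply: cvgB; [exact: cw|exact: cw'].
apply: (@le_trans _ _ (M * v `^ a / Gamma (a + 1))).
  by apply: RL_bound => //; exact: continuous_measurable_fun.
rewrite mulrAC ler_wpM2l ?divr_ge0 ?(ltW g0)//.
by apply: ge0_ler_powR; rewrite ?nnegrE ?(ltW a0) ?(le_trans v0 vT).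
Qed.

(** The values of the fractional integral at [v], [T] and [e] all vary by at most K = M T^a /
    Gamma(a+1). The coefficient of the linear term then varies by at most (K + |lam| K) / |lam e -
    T|, and v <= T turns T^a into T^(a+1). *)
Lemma bvp_op_lipschitz (a lam e T v M : R) w w' : 0 < a ->
  0 <= e <= T -> 0 <= v <= T -> lam * e - T != 0 ->
  continuous w -> continuous w' -> (forall v, `|w v - w' v| <= M) ->
  `|bvp_op a lam e T w v - bvp_op a lam e T w' v| <=
  M / Gamma (a + 1) *
    (T `^ a + (`|lam| + 1) / `|lam * e - T| * T `^ (a + 1)).
Proof.
move=> a0 eT vT nz cw cw' wM; have /andP[v0 vT'] := vT.
have T0 : 0 <= T by exact: le_trans vT'.
have TT : 0 <= T <= T by rewrite T0 lexx.
have Hv := RL_lipschitz a T v M w w' a0 cw cw' wM vT.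
have HT := RL_lipschitz a T T M w w' a0 cw cw' wM TT.
have He := RL_lipschitz a T e M w w' a0 cw cw' wM eT.
have -> : T `^ (a + 1) = T `^ a * T.
  by rewrite powRD ?powRr1//; rewrite (gt_eqF (addr_gt0 a0 ltr01)).
rewrite /bvp_op; move: Hv HT He; set K := M / _ * _.
move: (RL a w v) (RL a w' v) (RL a w T) (RL a w' T) (RL a w e) (RL a w' e).
move=> A A' B B' E E' Hv HT He.
have K0 : 0 <= K by exact: le_trans Hv.
have d0 : 0 < `|lam * e - T| by rewrite normr_gt0.
have -> : A + (B - lam * E) / (lam * e - T) * v - (A' + (B' - lam * E') / (lam * e - T) * v)
  = (A - A') + (B - B' - lam * (E - E')) / (lam * e - T) * v by ring.
apply: (@le_trans _ _ (K + (K + `|lam| * K) / `|lam * e - T| * T)); last first.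
  by rewrite le_eqVlt; apply/orP; left; apply/eqP; rewrite /K; ring.
apply: le_trans (ler_normD _ _) _; apply: lerD => //.
rewrite !normrM normfV (ger0_norm v0); apply: ler_pM => //.
rewrite ler_pM2r ?invr_gt0//.
apply: le_trans (ler_normB _ _) _; apply: lerD => //.
by rewrite normrM ler_wpM2l.
Qed.

(** For x = RL a w + c v the condition at 1 is linear in [c], with coefficient lam e - T up to sign;
    this being nonzero, it has exactly the solution built into [bvp_op]. *)
Lemma bvp_solutionP psi (a lam eta : R) w (x : R -> R) :
  time_change (fun t => psi t - psi 0) (deriv01 psi) ->
  1 < a < 2 -> 0 < eta < 1 ->
  lam * (psi eta - psi 0) - (psi 1 - psi 0) != 0 ->
  continuous w -> {within `[0, 1], continuous x} ->
  [/\ caputo_derivable a psi x,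
      forall t, 0 <= t <= 1 -> caputo_deriv a psi x t = w (psi t - psi 0),
      x 0 = 0 & x 1 = lam * x eta] <->
  (forall t, 0 <= t <= 1 -> x t =
    bvp_op a lam (psi eta - psi 0) (psi 1 - psi 0) w (psi t - psi 0)).
Proof.
move=> tc a12 /andP[eta0 eta1] nz cw cx.
have i0 : 0 <= (0 : R) <= 1 by rewrite lexx ler01.
have i1 : 0 <= (1 : R) <= 1 by rewrite lexx ler01.
have ie : 0 <= eta <= 1 by rewrite !ltW.
split=> [[dx cE x0 x1] | xE].
- have [c xE] := caputo_RL_inv psi a tc a12 w x cw cx x0 dx cE.
  move=> t t01; rewrite /bvp_op xE//; congr (_ + _ * _).
  move: x1; rewrite !xE// => x1.
  apply: (mulIf nz); rewrite divfK//; move: x1.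
  move: (RL a w _) (RL a w _) => A B; lra.
- have [dx cE] := caputo_RL psi a tc a12 _ w x cw xE.
  split => //; first by rewrite xE// /bvp_op subrr RL_le0// mulr0 addr0.
  rewrite !xE// /bvp_op; move: nz (RL a w _) (RL a w _) => {xE cE tc}.
  move: (psi eta - psi 0) (psi 1 - psi 0) => e T nz A B; field; exact: nz.
Qed.

Lemma continuous_rhs (f : R -> R -> R -> R) q (X Y : R -> R) :
  {within `[0, 1] `*` setT,
    continuous (fun p : R * (R * R) => f p.1 p.2.1 p.2.2)} ->
  continuous q -> (forall v, 0 <= q v <= 1) -> continuous X -> continuous Y ->
  continuous (fun v => f (q v) (X v) (Y v)).
Proof.
move=> /subspace_continuousP cf cq q01 cX cY v.
pose c v := (q v, (X v, Y v)).
have cA u : (`[0, 1] `*` setT)%classic (c u) by split => //=; rewrite in_itv/=.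
apply: (@cvg_comp _ _ _ c (fun p : R * (R * R) => f p.1 p.2.1 p.2.2) _
  (within (`[0, 1] `*` setT) (nbhs (c v)))); last exact: cf.
have cc : c u @[u --> v] --> c v.
  exact: (cvg_pair (cq v) (cvg_pair (cX v) (cY v))).
move=> P /cc H; have {H} : nbhs v (fun u => (`[0, 1] `*` setT)%classic (c u) -> P (c u)) by [].
by apply: filterS => u; apply.
Qed.

Section System.
Variables (alpha beta eta xi lambda mu : R) (psi q : R -> R).
Variables (f g : R -> R -> R -> R).
Let p t := psi t - psi 0.
Hypothesis tc : time_change p (deriv01 psi).
Hypothesis alpha12 : 1 < alpha < 2.
Hypothesis beta12 : 1 < beta < 2.
Hypothesis eta01 : 0 < eta < 1.
Hypothesis xi01 : 0 < xi < 1.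
Hypothesis nz1 : lambda * p eta - p 1 != 0.
Hypothesis nz2 : mu * p xi - p 1 != 0.
Hypothesis cf : {within `[0, 1] `*` setT,
  continuous (fun p : R * (R * R) => f p.1 p.2.1 p.2.2)}.
Hypothesis cg : {within `[0, 1] `*` setT,
  continuous (fun p : R * (R * R) => g p.1 p.2.1 p.2.2)}.
Hypothesis cq : continuous q.
Hypothesis q01 : forall v, 0 <= q v <= 1.
Hypothesis qp : forall t, 0 <= t <= 1 -> q (p t) = t.

(** Evaluation at [p (q v)] instead of [v] confines the argument to [0, p 1]. The operator thus has
    bounded values, its estimates hold on all of R, and its fixed points depend on [v] through [q v]
    alone. *)
Definition system_op1 (X Y : R -> R) (v : R) : R :=
  bvp_op alpha lambda (p eta) (p 1) (fun u => f (q u) (X u) (Y u)) (p (q v)).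

Definition system_op2 (X Y : R -> R) (v : R) : R :=
  bvp_op beta mu (p xi) (p 1) (fun u => g (q u) (X u) (Y u)) (p (q v)).

Let inT t : 0 <= t <= 1 -> 0 <= p t <= p 1.
Proof.
move=> t01; rewrite (time_change_ge0 p (deriv01 psi))//=.
by have /andP[t0 t1] := t01; exact: (time_change_le p (deriv01 psi)).
Qed.

Let cpq : continuous (fun v => p (q v)).
Proof.
apply: (@continuous_comp_within _ p q `[0, 1]%classic) => //.
exact: time_change_continuous tc.
Qed.

Lemma system_op_continuous X Y : continuous X -> continuous Y ->
  continuous (system_op1 X Y) /\ continuous (system_op2 X Y).
Proof.
move=> cX cY; have /andP[al1 _] := alpha12; have /andP[be1 _] := beta12.
split => v.
- apply: (@cvg_comp _ _ _ (fun v => p (q v)) _ _ (nbhs (p (q v)))); first exact: cpq.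
  by apply: bvp_op_continuous => //; exact: continuous_rhs.
- apply: (@cvg_comp _ _ _ (fun v => p (q v)) _ _ (nbhs (p (q v)))); first exact: cpq.
  by apply: bvp_op_continuous => //; exact: continuous_rhs.
Qed.

Lemma system_op_bounded X Y : continuous X -> continuous Y ->
  exists D, forall v, `|system_op1 X Y v| + `|system_op2 X Y v| <= D.
Proof.
move=> cX cY; have /andP[al1 _] := alpha12; have /andP[be1 _] := beta12.
have c1 := bvp_op_continuous alpha lambda (p eta) (p 1) _ al1
  (continuous_rhs f q X Y cf cq q01 cX cY).
have c2 := bvp_op_continuous beta mu (p xi) (p 1) _ be1
  (continuous_rhs g q X Y cg cq q01 cX cY).
have [D1 [_ D1P]] := continuous_bounded_itv _ 0 (p 1) c1.
have [D2 [_ D2P]] := continuous_bounded_itv _ 0 (p 1) c2.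
by exists (D1 + D2) => v; apply: lerD; [apply: D1P|apply: D2P]; exact: inT.
Qed.

Lemma system_fixpointP (x y : R -> R) :
  {within `[0, 1], continuous x} -> {within `[0, 1], continuous y} ->
  is_solution alpha beta eta xi lambda mu psi f g x y <->
  system_op1 (x \o q) (y \o q) = x \o q /\ system_op2 (x \o q) (y \o q) = y \o q.
Proof.
move=> cx cy.
have cxq : continuous (x \o q).
  by apply: (@continuous_comp_within _ x q `[0, 1]%classic) => // v; rewrite /= in_itv/=.
have cyq : continuous (y \o q).
  by apply: (@continuous_comp_within _ y q `[0, 1]%classic) => // v; rewrite /= in_itv/=.
have Px := bvp_solutionP psi alpha lambda eta _ x tc alpha12 eta01 nz1
  (continuous_rhs f q _ _ cf cq q01 cxq cyq) cx.
have Py := bvp_solutionP psi beta mu xi _ y tc beta12 xi01 nz2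
  (continuous_rhs g q _ _ cg cq q01 cxq cyq) cy.
split.
- move=> [_ [dx dy] E [x0 y0] [x1 y1]]; split; apply/funext => v.
    apply/esym/(Px.1 _ (q v) (q01 v)); split => // t t01.
    by have [] := E t; rewrite ?in_itv//= => -> _; rewrite -/(p t) qp.
  apply/esym/(Py.1 _ (q v) (q01 v)); split => // t t01.
  by have [] := E t; rewrite ?in_itv//= => _ ->; rewrite -/(p t) qp.
- move=> [/funeqP E1 /funeqP E2].
  have [|dx Ex x0 x1] := Px.2.
    by move=> t t01; have := E1 (p t); rewrite /system_op1/= qp.
  have [|dy Ey y0 y1] := Py.2.
    by move=> t t01; have := E2 (p t); rewrite /system_op2/= qp.
  split => // t; rewrite in_itv => t01.
  by rewrite Ex// Ey//= -/(p t) qp.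
Qed.

Variables (L1 L2 : R).
Hypothesis fL : {in `[0, 1], forall t x1 x2 y1 y2,
  `|f t x1 y1 - f t x2 y2| <= L1 * (`|x1 - x2| + `|y1 - y2|)}.
Hypothesis gL : {in `[0, 1], forall t x1 x2 y1 y2,
  `|g t x1 y1 - g t x2 y2| <= L2 * (`|x1 - x2| + `|y1 - y2|)}.
Hypothesis L10 : 0 <= L1.
Hypothesis L20 : 0 <= L2.

(** The Lipschitz conditions involve the sum of both differences, so the same [M] enters each
    component and the two constants simply add. *)
Lemma system_op_lipschitz X Y X' Y' M :
  continuous X -> continuous Y -> continuous X' -> continuous Y' ->
  (forall v, `|X v - X' v| + `|Y v - Y' v| <= M) ->
  forall v, `|system_op1 X Y v - system_op1 X' Y' v| +
            `|system_op2 X Y v - system_op2 X' Y' v| <=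
    (L1 / Gamma (alpha + 1) * (p 1 `^ alpha +
       (`|lambda| + 1) / `|lambda * p eta - p 1| * p 1 `^ (alpha + 1)) +
     L2 / Gamma (beta + 1) * (p 1 `^ beta +
       (`|mu| + 1) / `|mu * p xi - p 1| * p 1 `^ (beta + 1))) * M.
Proof.
move=> cX cY cX' cY' XM v; have /andP[al1 _] := alpha12; have /andP[be1 _] := beta12.
have /andP[eta0 eta1] := eta01; have /andP[xi0 xi1] := xi01.
rewrite [leRHS]mulrDl; apply: lerD.
- apply: (@le_trans _ _ (L1 * M / Gamma (alpha + 1) * (p 1 `^ alpha +
       (`|lambda| + 1) / `|lambda * p eta - p 1| * p 1 `^ (alpha + 1)))).
    apply: bvp_op_lipschitz => //.
    + exact: lt_trans al1.
    + by apply: inT; rewrite !ltW.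
    + exact: inT.
    + exact: continuous_rhs.
    + exact: continuous_rhs.
    + move=> u; apply: le_trans (fL (q u) _ _ _ _ _) _; first by rewrite in_itv/=.
      by rewrite ler_wpM2l.
  by rewrite le_eqVlt; apply/orP; left; apply/eqP; rewrite -!mulrA; congr (_ * _); rewrite mulrC !mulrA.
- apply: (@le_trans _ _ (L2 * M / Gamma (beta + 1) * (p 1 `^ beta +
       (`|mu| + 1) / `|mu * p xi - p 1| * p 1 `^ (beta + 1)))).
    apply: bvp_op_lipschitz => //.
    + exact: lt_trans be1.
    + by apply: inT; rewrite !ltW.
    + exact: inT.
    + exact: continuous_rhs.
    + exact: continuous_rhs.
    + move=> u; apply: le_trans (gL (q u) _ _ _ _ _) _; first by rewrite in_itv/=.
      by rewrite ler_wpM2l.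
  by rewrite le_eqVlt; apply/orP; left; apply/eqP; rewrite -!mulrA; congr (_ * _); rewrite mulrC !mulrA.
Qed.
End System.
End ThreePointProblem.

Theorem theorem3p3 (R : realType) (alpha beta eta xi lambda mu : R)
    (psi : R -> R) (f g : R -> R -> R -> R) (L1 L2 : R)
    (halpha : 1 < alpha < 2) (hbeta : 1 < beta < 2)
    (heta : 0 < eta < 1) (hxi : 0 < xi < 1)
    (hlambda : 0 < lambda) (hmu : 0 < mu)
    (hpsiC2 : C2_01 psi)
    (hpsi_incr : {in `[0, 1] &, {homo psi : s t / s < t}})
    (hpsi_deriv : {in `[0, 1], forall t, deriv01 psi t != 0}) :
  let Delta1 := lambda * (psi eta - psi 0) - (psi 1 - psi 0) in
  let Delta2 := mu * (psi xi - psi 0) - (psi 1 - psi 0) in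
  Delta1 != 0 -> Delta2 != 0 ->
  {within `[0, 1] `*` setT,
    continuous (fun p : R * (R * R) => f p.1 p.2.1 p.2.2)} ->
  {within `[0, 1] `*` setT,
    continuous (fun p : R * (R * R) => g p.1 p.2.1 p.2.2)} ->
  0 < L1 -> 0 < L2 ->
  {in `[0, 1], forall t x1 x2 y1 y2,
    `|f t x1 y1 - f t x2 y2| <= L1 * (`|x1 - x2| + `|y1 - y2|)} ->
  {in `[0, 1], forall t x1 x2 y1 y2,
    `|g t x1 y1 - g t x2 y2| <= L2 * (`|x1 - x2| + `|y1 - y2|)} ->
  let gamma3 := L1 / Gamma (alpha + 1) *
    ((psi 1 - psi 0) `^ alpha +
     (`|lambda| + 1) / `|Delta1| * (psi 1 - psi 0) `^ (alpha + 1)) in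
  let gamma4 := L2 / Gamma (beta + 1) *
    ((psi 1 - psi 0) `^ beta +
     (`|mu| + 1) / `|Delta2| * (psi 1 - psi 0) `^ (beta + 1)) in
  gamma3 + gamma4 < 1 ->
  exists x y : R -> R,
    is_solution alpha beta eta xi lambda mu psi f g x y /\
    forall x' y' : R -> R,
      is_solution alpha beta eta xi lambda mu psi f g x' y' ->
      {in `[0, 1], forall t, x' t = x t /\ y' t = y t}.
Proof.
move=> Delta1 Delta2 nz1 nz2 cf cg L10 L20 fL gL gamma3 gamma4 gamma1.
pose p t := psi t - psi 0.
have tc : time_change p (deriv01 psi) by exact: time_change_psi.
have [q [cq q01 qp]] := time_change_inverse p _ tc.
pose F1 := system_op1 alpha eta lambda psi q f.
pose F2 := system_op2 beta xi mu psi q g.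
have qpq v : q (p (q v)) = q v by rewrite qp.
have Fcont := system_op_continuous alpha beta eta xi lambda mu psi q f g
  tc halpha hbeta cf cg cq q01.
have Flip := system_op_lipschitz alpha beta eta xi lambda mu psi q f g
  tc halpha hbeta heta hxi nz1 nz2 cf cg cq q01 L1 L2 fL gL (ltW L10) (ltW L20).
have k01 : 0 <= gamma3 + gamma4 < 1.
  rewrite gamma1 andbT.
  have /andP[al1 _] := halpha; have /andP[be1 _] := hbeta.
  have ga : 0 < Gamma (alpha + 1) by rewrite Gamma_gt0// !addr_gt0// (lt_trans _ al1).
  have gb : 0 < Gamma (beta + 1) by rewrite Gamma_gt0// !addr_gt0// (lt_trans _ be1).
  apply: addr_ge0; apply: mulr_ge0; rewrite ?divr_ge0 ?(ltW L10) ?(ltW L20) ?(ltW ga) ?(ltW gb)//;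
    by rewrite addr_ge0 ?mulr_ge0 ?powR_ge0 ?divr_ge0 ?addr_ge0.
have c0 : continuous (fun _ : R => 0 : R) by move=> v; exact: cvg_cst.
have [D FD] := system_op_bounded alpha beta eta xi lambda mu psi q f g
  tc halpha hbeta cf cg cq q01 _ _ c0 c0.
have [X [Y [cX cY FX FY]]] := coupled_fixpoint F1 F2 _ k01 Flip Fcont D FD.
pose x t := X (p t); pose y t := Y (p t).
(* A fixed point is a value of the operator, hence unchanged when [v] is replaced by [p (q v)]; so
   nothing is lost in passing to functions on [0,1]. *)
have xqE : x \o q = X.
  by apply/funext => v; rewrite /x/= -FX /F1 /system_op1 -/(p _) qpq.
have yqE : y \o q = Y.
  by apply/funext => v; rewrite /y/= -FY /F2 /system_op2 -/(p _) qpq.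
have /subspace_continuousP cp := time_change_continuous p _ tc.
have cx : {within `[0, 1], continuous x}.
  apply/subspace_continuousP => t t01.
  by apply: (@cvg_comp _ _ _ p X _ (nbhs (p t))); [exact: cp|exact: cX].
have cy : {within `[0, 1], continuous y}.
  apply/subspace_continuousP => t t01.
  by apply: (@cvg_comp _ _ _ p Y _ (nbhs (p t))); [exact: cp|exact: cY].
have P := system_fixpointP alpha beta eta xi lambda mu psi q f g
  tc halpha hbeta heta hxi nz1 nz2 cf cg cq q01 qp.
exists x, y; split; first by apply/(P x y cx cy); rewrite xqE yqE.
move=> x' y' S; have [[cx' cy'] _ _ _ _] := S.
have [FX' FY'] := (P x' y' cx' cy').1 S.
have cxq : continuous (x' \o q).
  by apply: (@continuous_comp_within _ x' q `[0, 1]%classic) => // v; rewrite /= in_itv/=.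
have cyq : continuous (y' \o q).
  by apply: (@continuous_comp_within _ y' q `[0, 1]%classic) => // v; rewrite /= in_itv/=.
(* Provides the finite initial distance for uniqueness: continuous functions are bounded on
   [0, p 1], and all those compared take the same value at [v] and at [p (q v)]. *)
have bnd (h h' : R -> R) : continuous h -> continuous h' ->
    exists M, forall t, 0 <= t <= p 1 -> `|h t - h' t| <= M.
  move=> ch ch'; have cB : continuous (fun v => h v - h' v).
    by move=> v; apply: cvgB; [exact: ch|exact: ch'].
  by have [M [_ MP]] := continuous_bounded_itv _ 0 (p 1) cB; exists M.
have [M1 M1P] := bnd _ _ cxq cX; have [M2 M2P] := bnd _ _ cyq cY.
have inT t : 0 <= t <= 1 -> 0 <= p t <= p 1.
  move=> t01; rewrite (time_change_ge0 p _ t tc)//=.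
  by have /andP[t0 t1] := t01; exact: (time_change_le p _ t 1 tc).
have [|E1 E2] := coupled_fixpoint_unique F1 F2 _ k01 Flip _ _ _ _ (M1 + M2)
  cxq cyq cX cY FX' FY' FX FY.
  move=> v; apply: lerD.
    have := M1P _ (inT _ (q01 v)); rewrite /= qpq.
    by rewrite -[in X (p (q v))]xqE /= qpq -[X]xqE.
  have := M2P _ (inT _ (q01 v)); rewrite /= qpq.
  by rewrite -[in Y (p (q v))]yqE /= qpq -[Y]yqE.
move=> t; rewrite in_itv => t01.
by rewrite /x /y -E1 -E2 /= qp.
Qed.
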